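(* Let $M^n\times\mathbb{R}$ be a Riemannian cylinder with a product weight $e^{\psi(p,t)}:=e^{h(p)}\,e^{v(t)}$, where $h\in C^\infty(M)$, $v\in C^\infty(\mathbb{R})$, and $v'\geq\lambda$ on $\mathbb{R}$ for some constant $\lambda\geq 0$. Consider a two-sided, compact and connected hypersurface $\Sigma\subset M\times\mathbb{R}$ with $\partial\Sigma\neq\emptyset$ such that $|H_\psi|\leq\lambda$, or such that $\Sigma$ is a horizontal multigraph with $H_\psi\leq\lambda$. If $\partial\Sigma\subset M\times(-\infty,a]$ for some $a\in\mathbb{R}$, then $\Sigma\subset M\times(-\infty,a]$. Moreover, if $\Sigma$ intersects $M_a$ away from $\partial\Sigma$, or $\langle\xi,\nu\rangle\geq 0$ along $\partial\Sigma$, then $\Sigma\subseteq M_s$ for some $s\in\mathbb{R}$ with $v'(s)=\lambda$.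
   Context: A Riemannian cylinder $M^n\times\mathbb{R}$ is the Riemannian product of a complete, connected, oriented $n$-dimensional Riemannian manifold $M$ (possibly with smooth boundary) with the standard line $\mathbb{R}$. The unit parallel vertical vector field is $\xi(p,t):=(0,1)$, and $M_s:=M\times\{s\}$ is the horizontal slice at height $s$. For a two-sided smooth hypersurface $\Sigma$ (possibly with smooth boundary $\partial\Sigma$) with unit normal (Gauss map) $N$, the $\psi$-mean curvature is $H_\psi:=-\operatorname{div}_\Sigma N-\langle\nabla\psi,N\rangle$, and $\nu$ denotes the inner unit conormal of $\Sigma$ along $\partial\Sigma$. A horizontal multigraph is a two-sided connected hypersurface with a Gauss map $N$ such that $\langle\xi,N\rangle\leq 0$ on $\Sigma$; its $\psi$-mean curvature is computed with respect to this $N$. ''$\Sigma$ intersects $M_a$ away from $\partial\Sigma$'' means $(\Sigma\setminus\partial\Sigma)\cap M_a\neq\emptyset$. *)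

(* Defs.v *)
From HB Require Import structures.
From mathcomp Require Import all_boot all_order all_algebra.
From mathcomp Require Import all_classical all_reals all_analysis.

Set Implicit Arguments.
Unset Strict Implicit.
Unset Printing Implicit Defensive.

Import Order.TTheory GRing.Theory Num.Theory.
Import numFieldNormedType.Exports.

Local Open Scope classical_set_scope.
Local Open Scope ring_scope.

(** * Calculus up to the boundary

  Vectors are row vectors. The relevant domains [A] are relatively open subsets
  of a half-space (or of a half-space times a line), so derivatives are taken
  relatively to [A]: in the interior they are the usual ones and at boundary
  points the transversal one is one-sided. *)

Definition pdiff_quot (R : realType) (m : nat) (k : 'I_m)
    (f : 'rV[R]_m -> R) (x : 'rV[R]_m) (h : R) : R :=
  h^-1 * (f (x + h *: delta_mx 0 k) - f x).

Definition pincr (R : realType) (m : nat) (A : set 'rV[R]_m) (k : 'I_m)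
    (x : 'rV[R]_m) : set_system R :=
  within [set h | A (x + h *: delta_mx 0 k)] 0^'.

Definition pderivable (R : realType) (m : nat) (A : set 'rV[R]_m) (k : 'I_m)
    (f : 'rV[R]_m -> R) (x : 'rV[R]_m) : Prop :=
  cvg (pdiff_quot k f x @ pincr A k x).

Definition pderiv (R : realType) (m : nat) (A : set 'rV[R]_m) (k : 'I_m)
    (f : 'rV[R]_m -> R) (x : 'rV[R]_m) : R :=
  lim (pdiff_quot k f x @ pincr A k x).

Fixpoint Ck_on (R : realType) (m : nat) (A : set 'rV[R]_m) (r : nat)
    (f : 'rV[R]_m -> R) : Prop :=
  {within A, continuous f} /\
  if r is r'.+1 then
    forall k : 'I_m,
      (forall x, A x -> pderivable A k f x) /\ Ck_on A r' (pderiv A k f)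
  else True.

Definition smooth_on (R : realType) (m : nat) (A : set 'rV[R]_m)
    (f : 'rV[R]_m -> R) : Prop :=
  forall r, Ck_on A r f.

Definition smooth_on_vec (R : realType) (m l : nat) (A : set 'rV[R]_m)
    (F : 'rV[R]_m -> 'rV[R]_l) : Prop :=
  forall k : 'I_l, smooth_on A (fun x => F x 0 k).

(* Row [a] is the derivative of [F] in the direction [a]; hence tangent row
   vectors are pushed forward by multiplication on the right. *)
Definition jacobian (R : realType) (m l : nat) (A : set 'rV[R]_m)
    (F : 'rV[R]_m -> 'rV[R]_l) (x : 'rV[R]_m) : 'M[R]_(m, l) :=
  \matrix_(a, b) pderiv A a (fun z => F z 0 b) x.

Definition smooth_on_line (R : realType) (v : R -> R) : Prop :=
  forall (r : nat) (t : R), derivable (derive1n r v) t 1.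

(** * Smooth manifolds with boundary *)

(* The condition on the coordinate of index 0 is void when [m = 0], so that
   0-dimensional manifolds have empty boundary. *)
Definition half_space (R : realType) (m : nat) : set 'rV[R]_m :=
  [set x | forall k : 'I_m, val k = 0%N -> 0 <= x 0 k].

Definition half_space_bd (R : realType) (m : nat) : set 'rV[R]_m :=
  [set x | exists k : 'I_m, val k = 0%N /\ x 0 k = 0].

Definition half_space_open (R : realType) (m : nat) (A : set 'rV[R]_m) : Prop :=
  exists2 O : set 'rV[R]_m, open O & A = @half_space R m `&` O.

Record atlas (R : realType) (m : nat) := Atlas {
  carrier :> topologicalType;
  chart_index : Type;
  chart_dom : chart_index -> set carrier;
  chart : chart_index -> carrier -> 'rV[R]_m;
  chart_inv : chart_index -> 'rV[R]_m -> carrier }.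

Definition chart_codom (R : realType) (m : nat) (M : atlas R m)
    (i : chart_index M) :
  set 'rV[R]_m := chart i @` chart_dom i.

Definition overlap (R : realType) (m : nat) (M : atlas R m)
    (i j : chart_index M) :
  set 'rV[R]_m := chart i @` (chart_dom i `&` chart_dom j).

Definition transition (R : realType) (m : nat) (M : atlas R m)
    (i j : chart_index M) : 'rV[R]_m -> 'rV[R]_m :=
  chart j \o chart_inv i.

Definition transition_jac (R : realType) (m : nat) (M : atlas R m)
    (i j : chart_index M) (p : M) : 'M[R]_m :=
  jacobian (overlap i j) (transition i j) (chart i p).

Record smooth_manifold (R : realType) (m : nat) := SmoothManifold {
  smooth_atlas :> atlas R m;
  manifold_hausdorff : hausdorff_space smooth_atlas;
  manifold_second_countable : @second_countable smooth_atlas;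
  chart_dom_cover : forall p : smooth_atlas, exists i, chart_dom i p;
  chart_dom_open : forall i : chart_index smooth_atlas, open (chart_dom i);
  chart_codom_open : forall i : chart_index smooth_atlas,
      half_space_open (chart_codom i);
  chartK : forall (i : chart_index smooth_atlas) p,
    chart_dom i p -> chart_inv i (chart i p) = p;
  chart_continuous : forall i : chart_index smooth_atlas,
    {within chart_dom i, continuous (chart i)};
  chart_inv_continuous : forall i : chart_index smooth_atlas,
    {within chart_codom i, continuous (chart_inv i)};
  transition_smooth : forall i j : chart_index smooth_atlas,
    smooth_on_vec (overlap i j) (transition i j) }.

Definition mboundary (R : realType) (m : nat) (M : atlas R m) : set M :=
  [set p | exists2 i : chart_index M, chart_dom i p &
    half_space_bd (chart i p)].

Arguments mboundary {R m} M p.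

Definition smooth_fun (R : realType) (m : nat) (M : atlas R m) (f : M -> R) :
    Prop :=
  forall i : chart_index M, smooth_on (chart_codom i) (f \o chart_inv i).

(* An orientation is a continuous choice of a sign for each chart, telling
   whether the chart is positive. Since charts take values in a half-space,
   asking for an atlas with positive transition Jacobians would exclude
   1-dimensional manifolds such as [0, 1]. *)
Definition orientation (R : realType) (m : nat) (M : atlas R m)
    (o : chart_index M -> M -> R) : Prop :=
  [/\ forall i, {within chart_dom i, continuous (o i)},
      forall i p, chart_dom i p -> o i p = 1 \/ o i p = -1 &
      forall i j p, chart_dom i p -> chart_dom j p ->
        0 < o i p * o j p * \det (transition_jac i j p)].

(** * Riemannian metrics *)

Definition inner (R : realType) (m : nat) (G : 'M[R]_m) (u w : 'rV[R]_m) : R :=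
  (u *m G *m w^T) 0 0.

Record riemannian_metric (R : realType) (m : nat) (M : atlas R m) :=
  RiemannianMetric {
  metric :> chart_index M -> 'rV[R]_m -> 'M[R]_m;
  metric_smooth : forall i a b, smooth_on (chart_codom i)
      (fun x => metric i x a b);
  metric_sym : forall i x, chart_codom i x -> (metric i x)^T = metric i x;
  metric_pos : forall i x, chart_codom i x ->
    forall u, u != 0 -> 0 < inner (metric i x) u u;
  metric_transition : forall i j p, chart_dom i p -> chart_dom j p ->
    metric i (chart i p) =
    transition_jac i j p *m metric j (chart j p) *m (transition_jac i j p)^T }.

Definition C1_curve (R : realType) (m : nat) (c : R -> 'rV[R]_m) : Prop :=
  forall k : 'I_m,
    (forall t : R, derivable (fun s : R => c s 0 k) t 1) /\
    continuous (derive1 (fun s : R => c s 0 k)).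

Definition velocity (R : realType) (m : nat) (c : R -> 'rV[R]_m) (t : R) :
  'rV[R]_m := \row_k derive1 (fun s : R => c s 0 k) t.

Definition arc_length (R : realType) (m : nat) (G : 'rV[R]_m -> 'M[R]_m)
    (c : R -> 'rV[R]_m) : R :=
  Rintegral (@lebesgue_measure R) `[0, 1]
    (fun t : R => Num.sqrt (inner (G (c t)) (velocity c t) (velocity c t))).

(* [joined g p q l]: some piecewise C^1 curve from [p] to [q] has length [l].
   By compactness every such curve is a finite concatenation of C^1 arcs, each
   contained in the domain of a chart. *)
Inductive joined (R : realType) (m : nat) (M : atlas R m)
    (g : riemannian_metric M) : M -> M -> R -> Prop :=
| joined_refl p : joined g p p 0
| joined_arc p q l (i : chart_index M) (c : R -> 'rV[R]_m) :
    joined g p q l ->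
    C1_curve c ->
    (forall t, 0 <= t <= 1 -> chart_codom i (c t)) ->
    chart_inv i (c 0) = q ->
    joined g p (chart_inv i (c 1)) (l + arc_length (g i) c).

(* Completeness for the Riemannian distance, the infimum of the lengths. *)
Definition riemannian_complete (R : realType) (m : nat) (M : atlas R m)
    (g : riemannian_metric M) : Prop :=
  forall u : nat -> M,
    (forall e : R, 0 < e -> exists N : nat, forall a b : nat,
       (N <= a)%N -> (N <= b)%N -> exists2 l, joined g (u a) (u b) l & l < e) ->
    exists p : M, u @ \oo --> p.

(** * Levi-Civita calculus in coordinates, for a metric [G] on [A] *)

Definition christoffel (R : realType) (m : nat) (A : set 'rV[R]_m)
    (G : 'rV[R]_m -> 'M[R]_m) (x : 'rV[R]_m) (i j k : 'I_m) : R :=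
  2^-1 * \sum_(l < m) invmx (G x) k l *
    (pderiv A i (fun z => G z j l) x + pderiv A j (fun z => G z i l) x
     - pderiv A l (fun z => G z i j) x).

Definition gradient (R : realType) (m : nat) (A : set 'rV[R]_m)
    (G : 'rV[R]_m -> 'M[R]_m) (f : 'rV[R]_m -> R) (x : 'rV[R]_m) : 'rV[R]_m :=
  \row_k \sum_(l < m) invmx (G x) k l * pderiv A l f x.

(* Covariant derivative in the direction [a] of a vector field [W] along the
   parametrization [Y : D -> A]. *)
Definition cov_deriv (R : realType) (n m : nat) (A : set 'rV[R]_m)
    (G : 'rV[R]_m -> 'M[R]_m) (D : set 'rV[R]_n) (Y W : 'rV[R]_n -> 'rV[R]_m)
    (a : 'I_n) (u : 'rV[R]_n) : 'rV[R]_m :=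
  \row_k (jacobian D W u a k +
    \sum_(i < m) \sum_(j < m)
      christoffel A G (Y u) i j k * jacobian D Y u a i * W u 0 j).

Definition first_form (R : realType) (n m : nat) (G : 'rV[R]_m -> 'M[R]_m)
    (D : set 'rV[R]_n) (Y : 'rV[R]_n -> 'rV[R]_m) (u : 'rV[R]_n) : 'M[R]_n :=
  jacobian D Y u *m G (Y u) *m (jacobian D Y u)^T.

(* Divergence along the image of [Y] of a vector field [W], i.e. the sum of
   < nabla_{e_a} W, e_a > over an orthonormal basis of the tangent space,
   written in the coordinate basis. *)
Definition div_along (R : realType) (n m : nat) (A : set 'rV[R]_m)
    (G : 'rV[R]_m -> 'M[R]_m) (D : set 'rV[R]_n) (Y W : 'rV[R]_n -> 'rV[R]_m)
    (u : 'rV[R]_n) : R :=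
  \sum_(a < n) \sum_(b < n) invmx (first_form G D Y u) a b *
    inner (G (Y u)) (cov_deriv A G D Y W a u) (row b (jacobian D Y u)).

(** * The Riemannian cylinder [M * R]

  Each chart [i] of [M] gives the chart [cyl_chart i] of [M * R], the height
  being the last of the [n + 1] coordinates. *)

Definition cyl_codom (R : realType) (n : nat) (M : atlas R n)
    (i : chart_index M) :
    set 'rV[R]_(n + 1) :=
  [set y | chart_codom i (lsubmx y)].

Definition cyl_chart (R : realType) (n : nat) (M : atlas R n)
    (i : chart_index M)
    (q : M * R) : 'rV[R]_(n + 1) :=
  row_mx (chart i q.1) (const_mx q.2).

Definition cyl_chart_inv (R : realType) (n : nat) (M : atlas R n)
    (i : chart_index M) (y : 'rV[R]_(n + 1)) : M * R :=
  (chart_inv i (lsubmx y), y 0 (rshift n ord0)).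

Definition cyl_transition_jac (R : realType) (n : nat) (M : atlas R n)
    (i j : chart_index M) (q : M * R) : 'M[R]_(n + 1) :=
  block_mx (transition_jac i j q.1) 0 0 1%:M.

Definition cyl_metric (R : realType) (n : nat) (M : atlas R n)
    (g : riemannian_metric M) (i : chart_index M) (y : 'rV[R]_(n + 1)) :
    'M[R]_(n + 1) :=
  block_mx (g i (lsubmx y)) 0 0 1%:M.

Definition cyl_inner (R : realType) (n : nat) (M : atlas R n)
    (g : riemannian_metric M) (i : chart_index M) (q : M * R)
    (u w : 'rV[R]_(n + 1)) : R :=
  inner (cyl_metric g i (cyl_chart i q)) u w.

(* The vertical field (0, 1); its components are the same in all charts. *)
Definition xi (R : realType) (n : nat) : 'rV[R]_(n + 1) :=
  row_mx 0 (const_mx 1).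

(** * Hypersurfaces of the cylinder

  A hypersurface is an n-manifold [S] with boundary together with an immersion
  [F : S -> M * R]; embedded hypersurfaces are those for which [F] is the
  inclusion. *)

Definition loc_dom (R : realType) (n : nat) (M S : atlas R n)
    (F : S -> M * R) (a : chart_index S) (i : chart_index M) : set 'rV[R]_n :=
  chart a @` (chart_dom a `&` [set p | chart_dom i (F p).1]).

Definition loc_map (R : realType) (n : nat) (M S : atlas R n)
    (F : S -> M * R) (a : chart_index S) (i : chart_index M) :
    'rV[R]_n -> 'rV[R]_(n + 1) :=
  fun u => cyl_chart i (F (chart_inv a u)).

Definition loc_jac (R : realType) (n : nat) (M S : atlas R n)
    (F : S -> M * R) (a : chart_index S) (i : chart_index M) (p : S) :
    'M[R]_(n, n + 1) :=
  jacobian (loc_dom F a i) (loc_map F a i) (chart a p).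

Definition immersion (R : realType) (n : nat) (M S : atlas R n)
    (F : S -> M * R) : Prop :=
  [/\ continuous F,
      forall a i, smooth_on_vec (loc_dom F a i) (loc_map F a i) &
      forall a i p, chart_dom a p -> chart_dom i (F p).1 ->
        \rank (loc_jac F a i p) = n].

(* A smooth unit normal field along [F]; [N i p] is the row of components of
   N(p) in the chart [i] of the cylinder. *)
Definition gauss_map (R : realType) (n : nat) (M S : atlas R n)
    (g : riemannian_metric M) (F : S -> M * R)
    (N : chart_index M -> S -> 'rV[R]_(n + 1)) : Prop :=
  [/\ forall i j p, chart_dom i (F p).1 -> chart_dom j (F p).1 ->
        N j p = N i p *m cyl_transition_jac i j (F p),
      forall a i, smooth_on_vec (loc_dom F a i) (N i \o chart_inv a),
      forall i p, chart_dom i (F p).1 ->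
        cyl_inner g i (F p) (N i p) (N i p) = 1 &
      forall a i p, chart_dom a p -> chart_dom i (F p).1 -> forall c : 'rV[R]_n,
        cyl_inner g i (F p) (N i p) (c *m loc_jac F a i p) = 0].

Definition horizontal_multigraph (R : realType) (n : nat) (M S : atlas R n)
    (g : riemannian_metric M) (F : S -> M * R)
    (N : chart_index M -> S -> 'rV[R]_(n + 1)) : Prop :=
  [/\ connected [set: S], gauss_map g F N &
      forall i p, chart_dom i (F p).1 ->
        cyl_inner g i (F p) (@xi R n) (N i p) <= 0].

(* - div_S N - < nabla psi, N > at [p], computed in the charts [a] and [i]. *)
Definition weighted_mean_curvature (R : realType) (n : nat) (M S : atlas R n)
    (g : riemannian_metric M) (psi : M * R -> R) (F : S -> M * R)
    (N : chart_index M -> S -> 'rV[R]_(n + 1))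
    (a : chart_index S) (i : chart_index M) (p : S) :
    R :=
  - div_along (cyl_codom i) (cyl_metric g i) (loc_dom F a i)
      (loc_map F a i) (N i \o chart_inv a) (chart a p)
  - cyl_inner g i (F p)
      (gradient (cyl_codom i) (cyl_metric g i) (psi \o cyl_chart_inv i)
         (cyl_chart i (F p)))
      (N i p).

(* [w] is the inner unit conormal at [p], where [chart a] maps [p] to the
   boundary of the half-space. *)
Definition inner_conormal (R : realType) (n : nat) (M S : atlas R n)
    (g : riemannian_metric M) (F : S -> M * R) (a : chart_index S)
    (i : chart_index M)
    (p : S) (w : 'rV[R]_(n + 1)) : Prop :=
  [/\ exists2 c : 'rV[R]_n, w = c *m loc_jac F a i p &
        forall k : 'I_n, val k = 0%N -> 0 < c 0 k,
      forall c : 'rV[R]_n, (forall k : 'I_n, val k = 0%N -> c 0 k = 0) ->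
        cyl_inner g i (F p) w (c *m loc_jac F a i p) = 0 &
      cyl_inner g i (F p) w w = 1].

(* Main.v *)
(** The height [f] of the hypersurface satisfies
    [Lap f + <grad psi, grad f> = <xi, N> H_psi + v'(f)], because [xi] is parallel;
    since [|<xi, N>| <= 1], both curvature assumptions make the right-hand side
    nonnegative. In coordinates this is a linear elliptic inequality whose
    coefficients are continuous up to the boundary, so the strong maximum principle
    and Hopf's boundary lemma apply to a maximum of [f]: an interior maximum forces
    [f] to be constant, and at a boundary maximum the inner conormal derivative
    [<xi, nu>] of a nonconstant [f] is negative. If [f = s] is constant, then
    [<xi, N>^2 = 1] and [0 = <xi, N> H_psi + v'(s)], whence [v'(s) = lambda].

    Pairing with tangent vectors lowers the index of the Christoffel symbols, so the
    inverse of the ambient metric never appears and the drift of the inequality is an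
    explicit continuous function. *)
Require Import Defs.
From HB Require Import structures.
From mathcomp Require Import all_boot all_order all_algebra.
From mathcomp Require Import all_classical all_reals all_analysis.
From mathcomp Require Import ring lra.

Set Implicit Arguments.
Unset Strict Implicit.
Unset Printing Implicit Defensive.

Import Order.TTheory GRing.Theory Num.Theory.
Import numFieldNormedType.Exports.

Local Open Scope classical_set_scope.
Local Open Scope ring_scope.

(** Two boundaries interfere. Parameters range over a half-space, and since $M$ may have boundary,
    the image of an interior point of the hypersurface may still lie on the boundary of the
    cylinder. Hence every derivative is relative to its domain, and the chain rule must hold at
    boundary points. The elliptic inequality is asserted at interior parameters only. That is
    enough, because a comparison function is tested only at interior maxima; continuity of the
    coefficients up to the boundary serves to choose the constants of the barrier. The barrier is a
    polynomial of degree four. On each line its expansion is exact, so a second derivative test in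
    one variable suffices and no Taylor theorem in several variables enters. One form of Hopf's
    lemma serves twice: touching at an interior point is absurd, which yields the strong maximum
    principle, and touching at a boundary point gives linear decay along the inward direction. A
    maximum at a boundary point says nothing about its neighbours, so the set of maximum points need
    not be open; the connectedness argument is run on its interior. *)

(* Half-spaces, and their products with a line, are orthants with [P] the singleton
   of the coordinate of index 0. *)
Definition orthant (R : realType) (m : nat) (P : pred 'I_m) : set 'rV[R]_m :=
  [set x | forall k, P k -> 0 <= x 0 k].

Definition orthant_open (R : realType) (m : nat) (P : pred 'I_m)
    (A : set 'rV[R]_m) : Prop :=
  A `<=` @orthant R m P /\
  forall x, A x -> \forall y \near x, @orthant R m P y -> A y.

(** * Limits of row vectors and difference quotients *)

Lemma nbhs_rowP (R : realType) (m : nat) (x : 'rV[R]_m)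
    (Q : 'rV[R]_m -> Prop) :
  (\forall y \near x, Q y) <->
  exists2 e : R, 0 < e & forall y : 'rV[R]_m, (forall k, `|y 0 k - x 0 k| < e) -> Q y.
Proof.
split.
  move/nbhs_ballP => [e e0 eQ]; exists e => // y xy; apply: eQ.
  split=> // i j; rewrite /ball /= ord1 distrC; exact: xy.
move=> [e e0 eQ]; apply/nbhs_ballP; exists e => //= y [_ xy].
by apply: eQ => k; rewrite distrC; exact: xy.
Qed.

Lemma cvg_row (R : realType) (T : Type) (F : set_system T) (m : nat)
    (c : T -> 'rV[R]_m) (l : 'rV[R]_m) : Filter F ->
  (forall k, c t 0 k @[t --> F] --> l 0 k) -> c @ F --> l.
Proof.
move=> FF cl; apply/cvgrPdist_lt => e e0.
have : \forall t \near F, forall k, `|l 0 k - c t 0 k| < e.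
  by apply: filter_forall => k; move/cvgrPdist_lt : (cl k) => /(_ e e0).
apply: filterS => t cle.
rewrite -[`|_|]/(mx_norm (l - c t)) mx_normrE; apply: bigmax_lt => // -[i k] _.
by rewrite !mxE /= ord1; exact: cle.
Qed.

Lemma cvg_coord (R : realType) (T : Type) (F : set_system T) (m : nat)
    (c : T -> 'rV[R]_m) (l : 'rV[R]_m) k : Filter F ->
  c @ F --> l -> c t 0 k @[t --> F] --> l 0 k.
Proof.
move=> FF cl.
have := @coord_continuous R 1 m 0 k l.
by move=> h; apply: cvg_comp cl h.
Qed.

Lemma cvg_addr (R : realType) (T : Type) (F : set_system T) (f g : T -> R) (a b : R) :
  Filter F -> f @ F --> a -> g @ F --> b -> f t + g t @[t --> F] --> a + b.
Proof. by move=> FF; exact: cvgD. Qed.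

Lemma cvg_subr (R : realType) (T : Type) (F : set_system T) (f g : T -> R) (a b : R) :
  Filter F -> f @ F --> a -> g @ F --> b -> f t - g t @[t --> F] --> a - b.
Proof. by move=> FF; exact: cvgB. Qed.

Lemma cvg_mulr (R : realType) (T : Type) (F : set_system T) (f g : T -> R) (a b : R) :
  Filter F -> f @ F --> a -> g @ F --> b -> f t * g t @[t --> F] --> a * b.
Proof. by move=> FF; exact: cvgM. Qed.

Lemma cvg_sumr (R : realType) (T I : Type) (F : set_system T) (r : seq I)
    (P : pred I) (f : I -> T -> R) (l : I -> R) : Filter F ->
  (forall i, P i -> f i t @[t --> F] --> l i) ->
  \sum_(i <- r | P i) f i t @[t --> F] --> \sum_(i <- r | P i) l i.
Proof. by move=> FF; apply: (cvg_big (@add_continuous R)). Qed.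

Lemma cvg_prodr (R : realType) (T I : Type) (F : set_system T) (r : seq I)
    (P : pred I) (f : I -> T -> R) (l : I -> R) : Filter F ->
  (forall i, P i -> f i t @[t --> F] --> l i) ->
  \prod_(i <- r | P i) f i t @[t --> F] --> \prod_(i <- r | P i) l i.
Proof. by move=> FF; apply: (cvg_big (@mul_continuous R)). Qed.

Lemma cvg_to_within (T U : Type) (F : set_system T) (G : set_system U)
    (D : set U) (f : T -> U) : Filter F ->
  f @ F --> G -> (\forall t \near F, D (f t)) -> f @ F --> within D G.
Proof.
move=> FF fG fD Q wQ.
have {}wQ : \forall t \near F, D (f t) -> Q (f t) := fG _ wQ.
by apply: filterS2 fD wQ => t Dt; exact.
Qed.

Lemma shift_delta (R : realType) (m : nat) (x : 'rV[R]_m) (t : R) k j :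
  (x + t *: delta_mx 0 k) 0 j = x 0 j + t * (j == k)%:R.
Proof. by rewrite !mxE eqxx. Qed.

Lemma shift_deltaD (R : realType) (m : nat) (x : 'rV[R]_m) (s t : R) k :
  x + s *: delta_mx 0 k + t *: delta_mx 0 k = x + (s + t) *: delta_mx 0 k.
Proof. by rewrite -addrA scalerDl. Qed.

Lemma line_continuous (R : realType) (m : nat) (x c : 'rV[R]_m) (t : R) :
  x + s *: c @[s --> t] --> x + t *: c.
Proof. by apply: cvgD; [exact: cvg_cst|apply: cvgZ; [exact: cvg_id|exact: cvg_cst]]. Qed.

Lemma is_derive_quot (R : realType) (g : R -> R) (s l : R) :
  h^-1 * (g (s + h) - g s) @[h --> 0^'] --> l -> is_derive s 1 g l.
Proof.
move=> H.
have E : (fun h => h^-1 *: ((g \o shift s) (h *: 1) - g s)) =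
         (fun h => h^-1 * (g (s + h) - g s)).
  by apply/funext => h; rewrite /= [h *: 1]mulr1 (addrC h s).
apply: DeriveDef; first by apply/cvg_ex; exists l; rewrite E.
by apply/(@cvg_lim R^o) => //; rewrite E.
Qed.

Lemma derive_quot (R : realType) (g : R -> R) (s l : R) :
  is_derive s 1 g l -> h^-1 * (g (s + h) - g s) @[h --> 0^'] --> l.
Proof.
move=> gl; have /derivableP H : derivable g s 1 by [].
have E : (fun h => h^-1 *: ((g \o shift s) (h *: 1) - g s)) =
         (fun h => h^-1 * (g (s + h) - g s)).
  by apply/funext => h; rewrite /= [h *: 1]mulr1 (addrC h s).
rewrite -E -(@derive_val _ _ _ _ _ _ _ gl); have : derivable g s 1 by [].
exact.
Qed.

(** * Partial derivatives up to the boundary *)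

Section PartialDerivatives.
Variables (R : realType) (m : nat) (P : pred 'I_m) (A : set 'rV[R]_m).
Hypothesis oA : orthant_open P A.

(** Only coordinate [k] moves and the other sign conditions are inherited from [x], so for small [h]
    membership in [A] reduces to one inequality. *)
Lemma near_pincr k x (Q : R -> Prop) : A x ->
  (\forall h \near pincr A k x, Q h) ->
  \forall h \near 0^', (P k -> 0 <= x 0 k + h) -> Q h.
Proof.
case: oA => sA nA Ax wQ.
have : \forall h \near 0^',
    @orthant R m P (x + h *: delta_mx 0 k) -> A (x + h *: delta_mx 0 k).
  apply: nbhs_dnbhs.
  have := @line_continuous R m x (delta_mx 0 k) 0.
  by rewrite scale0r addr0 => /(_ _ (nA x Ax)).
move: wQ; rewrite /pincr near_withinE; apply: filterS2 => h hQ hA hP.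
apply/hQ/hA => j Pj; rewrite shift_delta.
have [jk|_] := eqVneq j k; last by rewrite mulr0 addr0; exact: (sA _ Ax).
by rewrite jk mulr1; apply: hP; rewrite -jk.
Qed.

(** Small positive increments are always admissible, even on the boundary; this makes the limit in
    [pderiv] unique. *)
Lemma pincr_proper k x : A x -> ProperFilter (pincr A k x).
Proof.
move=> Ax; apply: Build_ProperFilter => /(near_pincr Ax) n0.
have : \forall h \near (0:R)^'+, False.
  move: n0; rewrite /dnbhs /at_right !near_withinE; apply: filterS => h H h0.
  apply: H; first by rewrite gt_eqF.
  by move=> Pk; rewrite addr_ge0 ?(ltW h0)//; case: oA => sA _; exact: sA Ax _ Pk.
by move=> /filter_ex [].
Qed.

Lemma pincr_interior k x : A x -> (P k -> 0 < x 0 k) -> pincr A k x = 0^'.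
Proof.
move=> Ax x0; apply/seteqP; split => Q; last first.
  by rewrite /pincr /within /=; apply: filterS.
move/(near_pincr Ax) => nQ; have [Pk|/negP nPk] := boolP (P k); last first.
  by apply: filterS nQ => h; apply => /nPk.
have xk0 := x0 Pk; near=> h.
have : `|h| < x 0 k by near: h; apply: dnbhs0_lt.
rewrite ltr_norml => /andP[? _].
have : P k -> 0 <= x 0 k + h by move=> _; lra.
by near: h.
Unshelve. all: by end_near. Qed.

Lemma pderivE k f x (l : R) : A x ->
  pdiff_quot k f x @ pincr A k x --> l -> pderiv A k f x = l.
Proof.
move=> Ax fl; have pP := pincr_proper k Ax.
exact/(@cvg_lim R _ _ (pincr A k x)).
Qed.

Lemma cvg_pincr (T : Type) (F : set_system T) (c : T -> R) k x : Filter F ->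
  c @ F --> 0^' -> (\forall t \near F, A (x + c t *: delta_mx 0 k)) ->
  c @ F --> pincr A k x.
Proof.
by move=> FF c0 cA; exact: cvg_to_within. Qed.

Lemma cvg_mul_dnbhs0 (t : R) : t != 0 -> h * t @[h --> 0^'] --> (0 : R)^'.
Proof.
move=> t0; rewrite {2}/dnbhs; apply: cvg_to_within.
  have : (fun h : R => h * t) @ 0 --> 0 * t by apply: cvgMr_tmp; exact: cvg_id.
  by rewrite mul0r; apply: cvg_trans; apply: cvg_app; exact: nbhs_dnbhs.
near=> h; rewrite mulf_neq0//; near: h; exact: nbhs_dnbhs_neq.
Unshelve. all: by end_near. Qed.

(** A point strictly inside the segment has neighbours in [A] on both sides along direction [k], so
    there the relative derivative is the two-sided derivative of the restriction. At the two ends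
    only continuity is used. *)
Lemma pderiv_MVT (k : 'I_m) (f : 'rV[R]_m -> R) (q : 'rV[R]_m) (t : R) :
  {within A, continuous f} -> (forall x, A x -> pderivable A k f x) ->
  (forall s : R, 0 <= s <= 1 -> A (q + (s * t) *: delta_mx 0 k)) ->
  exists2 s : R, 0 <= s <= 1 & f (q + t *: delta_mx 0 k) - f q =
    pderiv A k f (q + (s * t) *: delta_mx 0 k) * t.
Proof.
move=> cf df sA.
have [->|t0] := eqVneq t 0.
  by exists 0; rewrite ?lexx ?ler01// scale0r addr0 subrr mulr0.
pose g (s : R) : R := f (q + (s * t) *: delta_mx 0 k).
have cts (s : R) : q + (r * t) *: delta_mx 0 k @[r --> s] -->
    q + (s * t) *: delta_mx 0 k.
  have H := @line_continuous R m q (t *: delta_mx 0 k) s.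
  rewrite scalerA in H; apply: cvg_trans H; apply: near_eq_cvg.
  by apply: nearW => r; rewrite scalerA.
have [s s01 E] : exists2 s : R, s \in `]0, 1[%R & g 1 - g 0 =
   (pderiv A k f (q + (s * t) *: delta_mx 0 k) * t) * (1 - 0).
  apply: (@MVT R g (fun s : R => pderiv A k f (q + (s * t) *: delta_mx 0 k) * t)).
  - exact: ltr01.
  - move=> s; rewrite in_itv /= => /andP[s0 s1].
    have As : A (q + (s * t) *: delta_mx 0 k) by apply: sA; rewrite !ltW.
    apply: is_derive_quot.
    have -> : (fun h => h^-1 * (g (s + h) - g s)) =
       (fun h : R => pdiff_quot k f (q + (s * t) *: delta_mx 0 k) (h * t) * t).
      apply/funext => h; rewrite /pdiff_quot /g shift_deltaD mulrDl.
      have [->|h0] := eqVneq h 0; first by rewrite !mul0r addr0 subrr !mulr0 mul0r.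
      by field; apply/andP.
    apply: cvgMr_tmp; apply: cvg_comp; last exact: df.
    apply: cvg_pincr; first exact: cvg_mul_dnbhs0.
    near=> h; rewrite shift_deltaD -mulrDl; apply: sA.
    have : `|h| < Num.min s (1 - s).
      by near: h; apply: dnbhs0_lt; rewrite lt_min s0 subr_gt0.
    by rewrite lt_min !ltr_norml => /andP[/andP[? _] /andP[_ ?]]; apply/andP; split; lra.
  - apply/subspace_continuousP => s; rewrite /= in_itv /= => s01.
    move/subspace_continuousP : cf => /(_ _ (sA _ s01)).
    move=> H; apply: cvg_comp; last exact: H.
    apply: cvg_to_within.
      apply: cvg_trans (cts s); apply: cvg_app; exact: cvg_within.
    by apply: filterS (near_withinT _ _) => r /=; rewrite in_itv /=; exact: sA.
exists s; first by move: s01; rewrite in_itv /= => /andP[/ltW -> /ltW ->].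
by move: E; rewrite /g mul1r mul0r scale0r addr0 subr0 mulr1.
Unshelve. all: by end_near. Qed.
End PartialDerivatives.

Section ChainRule.
Variables (R : realType) (m : nat) (P : pred 'I_m) (A : set 'rV[R]_m).
Hypothesis oA : orthant_open P A.
Implicit Types (f : 'rV[R]_m -> R) (x y : 'rV[R]_m).

(* Change the coordinates one at a time: the path stays in the box spanned by
   [x] and [y], hence in the orthant. *)
Lemma C1_expansion f x (e : R) : Ck_on A 1 f -> A x -> 0 < e ->
  \forall y \near x, A y ->
    `|f y - f x - \sum_k pderiv A k f x * (y 0 k - x 0 k)| <=
      e * \sum_k `|y 0 k - x 0 k|.
Proof.
move=> [cf df] Ax e0.
have [d d0 dP] : exists2 d : R, 0 < d & forall y, (forall k, `|y 0 k - x 0 k| < d) ->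
    @orthant R m P y -> A y /\ forall k, `|pderiv A k f x - pderiv A k f y| < e.
  apply/nbhs_rowP.
  have H0 k : \forall y \near x, A y -> `|pderiv A k f x - pderiv A k f y| < e.
    have [_ [/subspace_continuousP ck _]] := df k.
    have /cvgrPdist_lt := ck _ Ax; move=> /(_ _ e0).
    by rewrite near_withinE.
  have H1 := @filter_forall _ _ _ (nbhs x) (nbhs_filter x) H0.
  have [_ /(_ _ Ax)] := oA; apply: filterS2 H1 => y H1 H2 oy.
  by split=> [|k]; [exact: H2|apply: H1; exact: H2].
apply/nbhs_rowP; exists d => // y yd Ay.
have box (z : 'rV[R]_m) :
    (forall k, exists2 c : R, 0 <= c <= 1 &
       z 0 k = x 0 k + c * (y 0 k - x 0 k)) ->
    A z /\ forall k, `|pderiv A k f x - pderiv A k f z| < e.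
  move=> zb; apply: dP => k.
    have [c /andP[c0 c1] ->] := zb k; apply: le_lt_trans (yd k).
    rewrite addrAC subrr add0r normrM ler_piMl//.
    by rewrite ger0_norm.
  move=> Pk; have [c /andP[c0 c1] ->] := zb k.
  have [/(_ _ Ax k Pk) xk _] := oA; have [/(_ _ Ay k Pk) yk _] := oA.
  nra.
pose p (j : nat) : 'rV[R]_m := \row_k (if (k < j)%N then y 0 k else x 0 k).
have p0 : p 0%N = x by apply/rowP => k; rewrite mxE.
have pm : p m = y by apply/rowP => k; rewrite mxE ltn_ord.
have pS (j : 'I_m) : p j.+1 = p j + (y 0 j - x 0 j) *: delta_mx 0 j.
  apply/rowP => k; rewrite shift_delta !mxE ltnS.
  have [->|kj] := eqVneq k j; first by rewrite leqnn ltnn mulr1 addrC subrK.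
  by rewrite mulr0 addr0 leq_eqVlt (_ : (k == j :> nat) = false)//; apply/negbTE.
have tele : f y - f x = \sum_(j < m) (f (p j.+1) - f (p j)).
  by rewrite -(big_mkord xpredT (fun j => f (p j.+1) - f (p j))) telescope_sumr// p0 pm.
rewrite tele -sumrB mulr_sumr; apply: le_trans (ler_norm_sum _ _ _) _.
apply: ler_sum => j _.
have seg (s : R) : 0 <= s <= 1 -> forall k, exists2 c : R, 0 <= c <= 1 &
    (p j + (s * (y 0 j - x 0 j)) *: delta_mx 0 j) 0 k = x 0 k + c * (y 0 k - x 0 k).
  move=> s01 k; rewrite shift_delta mxE; have [->|kj] := eqVneq k j.
    by exists s => //; rewrite ltnn mulr1.
  rewrite mulr0 addr0; case: ifP => _.
    by exists 1; rewrite ?ler01 ?lexx// mul1r addrC subrK.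
  by exists 0; rewrite ?ler01 ?lexx// mul0r addr0.
have Aseg (s : R) (s01 : 0 <= s <= 1) := (box _ (seg s s01)).1.
have [s s01 E] := @pderiv_MVT R m A j f (p j) (y 0 j - x 0 j) cf (df j).1 Aseg.
rewrite pS E -mulrBl normrM ler_wpM2r// distrC ltW//.
by have [_ /(_ j)] := box _ (seg s s01).
Qed.

(** The curve may touch the boundary of the orthant at [x]; the first-order expansion, which is
    valid there, replaces differentiability on a full neighbourhood. *)
Lemma chain_rule f x (c : R -> 'rV[R]_m) (w : 'I_m -> R) :
  Ck_on A 1 f -> A x -> (\forall h \near 0^', A (c h)) ->
  (forall k, h^-1 * (c h 0 k - x 0 k) @[h --> 0^'] --> w k) ->
  h^-1 * (f (c h) - f x) @[h --> 0^'] --> \sum_k pderiv A k f x * w k.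
Proof.
move=> Cf Ax cA cw.
pose q h k := h^-1 * (c h 0 k - x 0 k).
have ck k : c h 0 k @[h --> 0^'] --> x 0 k.
  have H : h * q h k @[h --> 0^'] --> (0 : R) * w k.
    apply: cvgM; last exact: cw.
    exact: (@cvg_within _ (nbhs (0 : R))).
  have {}H : x 0 k + h * q h k @[h --> 0^'] --> x 0 k + (0 : R) * w k.
    by apply: cvgD H; exact: cvg_cst.
  move: H; rewrite mul0r addr0; apply: cvg_trans; apply: near_eq_cvg.
  near=> h; have h0 : h != 0 by near: h; exact: nbhs_dnbhs_neq.
  by rewrite /q mulrA divff// mul1r addrC subrK.
have cx : c @ 0^' --> x by exact: cvg_row.
have qw : \sum_k pderiv A k f x * q h k @[h --> 0^'] --> \sum_k pderiv A k f x * w k.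
  apply: cvg_sumr => k _; apply: cvgMl_tmp; exact: cw.
have qn : \sum_k `|q h k| @[h --> 0^'] --> \sum_k `|w k|.
  apply: cvg_sumr => k _; apply: cvg_norm; exact: cw.
pose W := \sum_k `|w k|; have W0 : 0 <= W by exact: sumr_ge0.
suff H : h^-1 * (f (c h) - f x) - \sum_k pderiv A k f x * q h k @[h --> 0^'] --> (0 : R).
  have H2 : h^-1 * (f (c h) - f x) - \sum_k pderiv A k f x * q h k +
      \sum_k pderiv A k f x * q h k @[h --> 0^'] --> 0 + \sum_k pderiv A k f x * w k.
    exact: cvgD H qw.
  rewrite add0r in H2; apply: cvg_trans H2; apply: near_eq_cvg.
  by apply: nearW => h /=; rewrite subrK.
apply/cvgr0Pnorm_le => e e0.
(* The expansion error is at most [e / (W + 1)] times [|h|] times the sum of the [|q h k|]. That sum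
   tends to [W], so it is eventually below [W + 1], which is moreover never zero. *)
have e1 : 0 < e / (W + 1) by rewrite divr_gt0//; lra.
have /cx cE := C1_expansion Cf Ax e1.
have qW : \forall h \near 0^', \sum_k `|q h k| < W + 1.
  by apply: (cvgr_lt W) qn _ _; lra.
near=> h; have h0 : h != 0 by near: h; exact: nbhs_dnbhs_neq.
have Ach : A (c h) by near: h.
have : `|f (c h) - f x - \sum_k pderiv A k f x * (c h 0 k - x 0 k)| <=
      e / (W + 1) * \sum_k `|c h 0 k - x 0 k| by move: Ach; near: h; exact: cE.
have -> : \sum_k pderiv A k f x * (c h 0 k - x 0 k) = h * \sum_k pderiv A k f x * q h k.
  by rewrite mulr_sumr; apply: eq_bigr => k _; rewrite /q; field.
have -> : \sum_k `|c h 0 k - x 0 k| = `|h| * \sum_k `|q h k|.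
  rewrite mulr_sumr; apply: eq_bigr => k _.
  by rewrite /q normrM normfV mulrA divff ?normr_eq0// mul1r.
move=> H; have hn : 0 < `|h| by rewrite normr_gt0.
rewrite -(ler_pM2l hn) -normrM mulrBr mulrA divff// mul1r.
apply: le_trans H _; rewrite mulrCA ler_pM2l//.
have qh : \sum_k `|q h k| < W + 1 by near: h.
rewrite mulrAC ler_pdivrMr ?ler_pM2l ?(ltW qh)//; lra.
Unshelve. all: by end_near. Qed.
End ChainRule.

(** * Positive definite matrices *)

Section PosDef.
Variable R : realType.

Definition posdef (m : nat) (G : 'M[R]_m) : Prop :=
  G^T = G /\ forall u : 'rV[R]_m, u != 0 -> 0 < inner G u u.

Lemma innerDm (m : nat) (G H : 'M[R]_m) u w : inner (G + H) u w = inner G u w + inner H u w.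
Proof. by rewrite /inner mulmxDr mulmxDl mxE. Qed.

Lemma innerZm (m : nat) (G : 'M[R]_m) a u w : inner (a *: G) u w = a * inner G u w.
Proof. by rewrite /inner -scalemxAr -scalemxAl mxE. Qed.

Lemma innerC (m : nat) (G : 'M[R]_m) u w : G^T = G -> inner G u w = inner G w u.
Proof.
move=> Gs; rewrite /inner -[in LHS](trmxK (u *m G *m w^T)) mxE.
by rewrite !trmx_mul trmxK Gs mulmxA.
Qed.

Lemma innerDl (m : nat) (G : 'M[R]_m) u v w : inner G (u + v) w = inner G u w + inner G v w.
Proof. by rewrite /inner !mulmxDl mxE. Qed.

Lemma innerZl (m : nat) (G : 'M[R]_m) a u w : inner G (a *: u) w = a * inner G u w.
Proof. by rewrite /inner -!scalemxAl mxE. Qed.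

Lemma innerDr (m : nat) (G : 'M[R]_m) u v w : inner G u (v + w) = inner G u v + inner G u w.
Proof. by rewrite /inner linearD /= mulmxDr mxE. Qed.

Lemma innerZr (m : nat) (G : 'M[R]_m) a u w : inner G u (a *: w) = a * inner G u w.
Proof. by rewrite /inner linearZ /= -scalemxAr mxE. Qed.

Lemma innerE (m : nat) (G : 'M[R]_m) u w :
  inner G u w = \sum_k \sum_l u 0 k * G k l * w 0 l.
Proof.
rewrite /inner mxE exchange_big /=; apply: eq_bigr => l _.
by rewrite !mxE mulr_suml.
Qed.

Lemma posdef_unit (m : nat) (G : 'M[R]_m) : posdef G -> G \in unitmx.
Proof.
move=> [_ Gp]; rewrite -row_free_unit -kermx_eq0; apply/eqP/row_matrixP => i.
rewrite row0; apply/eqP; apply: contraT => u0.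
have := Gp _ u0; rewrite /inner -mulmxA.
have -> : row i (kermx G) *m (G *m (row i (kermx G))^T) = 0.
  by rewrite mulmxA -row_mul mulmx_ker row0 mul0mx.
by rewrite mxE ltxx.
Qed.

Lemma posdef_inv (m : nat) (G : 'M[R]_m) : posdef G -> posdef (invmx G).
Proof.
move=> Gp; have Gu := posdef_unit Gp; case: Gp => Gs Gp; split.
  by rewrite trmx_inv Gs.
move=> u u0; have : u *m invmx G != 0.
  by apply: contraNneq u0 => /(congr1 (mulmx^~ G)); rewrite mulmxKV// mul0mx => ->.
move/Gp; rewrite /inner mulmxKV// trmx_mul trmx_inv Gs.
by rewrite mulmxA.
Qed.

Lemma inner_rank1 (m : nat) (v u : 'rV[R]_m) :
  inner (v^T *m v) u u = (u *m v^T) 0 0 ^+ 2.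
Proof.
rewrite /inner mulmxA -mulmxA mxE big_ord1 expr2; congr (_ * _).
by rewrite -[v *m u^T]trmxK mxE trmx_mul trmxK.
Qed.

(* Peel off one square at a time, by taking Schur complements. *)
Lemma posdef_tr_le0 (m : nat) (G W : 'M[R]_m) : posdef G ->
  (forall c : 'rV[R]_m, inner W c c <= 0) -> \tr (G *m W) <= 0.
Proof.
elim: m G W => [|m IH] G W [Gs Gp] Wn.
  by rewrite /mxtrace big_ord0.
rewrite -[m.+1]/(1 + m)%N in G W Gs Gp Wn *.
pose al := G 0 0.
pose v : 'rV[R]_(1 + m) := row 0 G.
pose Sc : 'M[R]_m := drsubmx (G - al^-1 *: (v^T *m v)).
have al0 : 0 < al.
  have := Gp (delta_mx 0 0); rewrite /inner trmx_delta -rowE -colE !mxE; apply.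
  apply/eqP => /matrixP/(_ 0 0); rewrite !mxE !eqxx /= => /eqP.
  by rewrite oner_eq0.
have aln0 : al != 0 by rewrite gt_eqF.
have l0 : lshift m (0 : 'I_1) = 0 by apply/val_inj.
(* Completing the square in the first coordinate; [Sc] is the Schur complement of the pivot [al]. *)
have GE : G = al^-1 *: (v^T *m v) + block_mx (0 : 'M[R]_1) 0 0 Sc.
  rewrite -[LHS](subrK (al^-1 *: (v^T *m v))) addrC; congr (_ + _).
  have v0 j : v 0 j = G 0 j by rewrite mxE.
  have Gr j : G j 0 = G 0 j by rewrite -{1}Gs mxE.
  have E i j : (G - al^-1 *: (v^T *m v)) i j = G i j - al^-1 * (G 0 i * G 0 j).
    by rewrite !mxE big_ord1 !mxE.
  apply/matrixP => i j.
  case: (split_ordP i) => i' ->; case: (split_ordP j) => j' ->;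
    rewrite ?ord1 ?block_mxEul ?block_mxEur ?block_mxEdl ?block_mxEdr ?l0.
  - by rewrite E -/al mxE mulrA mulVf// mul1r subrr.
  - by rewrite E -/al mxE mulrA mulVf// mul1r subrr.
  - by rewrite E -/al Gr mxE [_ * al]mulrC mulrA mulVf// mul1r subrr.
  - by rewrite [RHS]mxE [RHS]mxE.
have Ssym : Sc^T = Sc.
  rewrite /Sc trmx_drsub; congr drsubmx.
  by rewrite linearB linearZ /= trmx_mul trmxK Gs.
have innS t c : inner G (row_mx t c) (row_mx t c) =
    al^-1 * (row_mx t c *m v^T) 0 0 ^+ 2 + inner Sc c c.
  rewrite {1}GE innerDm; congr (_ + _).
    by rewrite innerZm inner_rank1.
  rewrite /inner mul_row_block !mulmx0 !addr0 add0r tr_row_mx mul_row_col.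
  by rewrite mul0mx add0r.
have Sp c : c != 0 -> 0 < inner Sc c c.
  (* This first coordinate makes [row_mx t c] orthogonal to [v], so the square in [innS] vanishes
     and positivity passes from [G] to [Sc]. *)
  move=> c0; pose t : 'rV[R]_1 := - al^-1 *: (c *m (rsubmx v)^T).
  have := innS t c.
  have -> : row_mx t c *m v^T = 0.
    rewrite -[v]hsubmxK tr_row_mx mul_row_col.
    have -> : lsubmx v = al%:M.
      by apply/matrixP => i j; rewrite !mxE !ord1 /= mulr1n l0.
    rewrite tr_scalar_mx mul_mx_scalar /t scalerA mulrN divff// scaleN1r.
    by rewrite addNr.
  rewrite mxE expr0n /= mulr0 add0r => <-; apply: Gp.
  apply: contraNneq c0 => /eqP; rewrite row_mx_eq0 => /andP[_ /eqP -> //].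
(* The rank-one part contributes [al^-1] times the value of [W] at [v]; the other part only sees the
   lower right block of [W], to which the induction hypothesis applies. *)
rewrite GE mulmxDl mxtraceD -[leRHS]addr0; apply: lerD.
  rewrite -scalemxAl mxtraceZ pmulr_rle0 ?invr_gt0//.
  by rewrite -mulmxA mxtrace_mulC [\tr _]trace_mx11; exact: Wn.
rewrite -[W]submxK mulmx_block !mul0mx !add0r mxtrace_block mxtrace0 add0r.
apply: IH => // c; have := Wn (row_mx 0 c).
rewrite -[W in inner W]submxK /inner mul_row_block !mul0mx !add0r.
by rewrite tr_row_mx mul_row_col trmx0 mulmx0 add0r.
Qed.
End PosDef.

Section MatrixLimits.
Variables (R : realType) (T : Type) (F : set_system T) (FF : Filter F).

Lemma cvg_det (m : nat) (M : T -> 'M[R]_m) (M0 : 'M[R]_m) :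
  (forall i j, M t i j @[t --> F] --> M0 i j) -> \det (M t) @[t --> F] --> \det M0.
Proof.
move=> cM; rewrite /determinant; apply: cvg_sumr => s _.
by apply: cvgMl_tmp; apply: cvg_prodr => i _; exact: cM.
Qed.

Lemma cvg_invmx (m : nat) (M : T -> 'M[R]_m) (M0 : 'M[R]_m) i j :
  (forall i j, M t i j @[t --> F] --> M0 i j) -> M0 \in unitmx ->
  invmx (M t) i j @[t --> F] --> invmx M0 i j.
Proof.
move=> cM uM; have dM := cvg_det cM.
have d0 : \det M0 != 0 by rewrite -unitfE -unitmxE.
have : (\det (M t))^-1 * cofactor (M t) j i @[t --> F] --> (\det M0)^-1 * cofactor M0 j i.
  apply: cvgM; first exact: cvgV.
  apply: cvgMl_tmp; apply: cvg_det => k l.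
  rewrite !mxE; have := cM (lift j k) (lift i l).
  by apply: cvg_trans; apply: near_eq_cvg; apply: nearW => t; rewrite !mxE.
rewrite {2}/invmx uM !mxE; apply: cvg_trans; apply: near_eq_cvg.
(* The cofactor formula holds only for invertible matrices, since [invmx] returns a singular matrix
   unchanged; near the limit the determinant is nonzero. *)
have /cvgrPdist_lt/(_ `|\det M0|) := dM; rewrite normr_gt0 => /(_ d0).
apply: filterS => t Mt; rewrite /invmx; case: ifPn; rewrite ?mxE//.
by rewrite unitmxE unitfE negbK => /eqP D; move: Mt; rewrite D subr0 ltxx.
Qed.
End MatrixLimits.

(** * The second derivative test in one variable *)

Section SecondDerivativeTest.
Variable R : realType.

(** If [d2] were positive, [g1] would be positive just to the right of its zero at 0, and the mean
    value theorem would give larger values of [g] there. *)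
Lemma second_derivative_test (g g1 : R -> R) (d2 : R) :
  (\forall t \near (0 : R), is_derive (t : R) 1 g (g1 t)) ->
  h^-1 * (g1 h - g1 0) @[h --> (0 : R)^'] --> d2 ->
  (\forall t \near (0 : R), g t <= g 0) -> g1 0 = 0 /\ d2 <= 0.
Proof.
move=> dg dg1 gmax.
have [e e0 eP] : exists2 e : R, 0 < e &
    forall t : R, `|t| < e -> is_derive t 1 g (g1 t) /\ g t <= g 0.
  have : nbhs (0 : R) [set t : R | is_derive t 1 g (g1 t) /\ g t <= g 0].
    exact: filterI dg gmax.
  move/nbhs_ballP => [e /= e0 eP].
  exists e => // t te; apply: eP.
  by rewrite -ball_normE /= sub0r normrN.
have g10 : g1 0 = 0.
  have ne : - e <= e by lra.
  have nrm (t : R) : t \in `]- e, e[%R -> `|t| < e.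
    by rewrite in_itv /= ltr_norml.
  have H : is_derive (0 : R) 1 g 0.
    apply: (derive1_at_max ne).
    - by move=> t /nrm /eP [].
    - by rewrite in_itv /= oppr_lt0 e0.
    - by move=> t /nrm /eP [].
  have e00 : `|0 : R| < e by rewrite normr0.
  have [H' _] := eP 0 e00.
  by have [_ <-] := H'; have [_ ->] := H.
split=> //; rewrite leNgt; apply/negP => d20.
have /(cvgr_gt d2) /(_ _ d20) := dg1.
move=> [d /= d0 dP].
pose t := Num.min d e / 2.
have mde : 0 < Num.min d e by rewrite lt_min d0.
have t0 : 0 < t by rewrite divr_gt0.
have tm : t < Num.min d e by rewrite /t; lra.
move: (tm); rewrite lt_min => /andP[td te].
have sm s : 0 <= s <= t -> `|s| < e.
  by move=> /andP[s0 st]; rewrite ger0_norm//; lra.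
have [c] : exists2 c, c \in `]0, t[%R & g t - g 0 = g1 c * (t - 0).
  apply: MVT => //; first move=> s.
    rewrite in_itv /= => /andP[s0 st]; apply: (eP s _).1; apply: sm.
    by rewrite !ltW.
  apply: derivable_within_continuous => s; rewrite in_itv /= => st.
  by have [] := eP s (sm s st).
rewrite in_itv /= subr0 => /andP[c0 ct] E.
have : 0 < c^-1 * (g1 c - g1 0).
  apply: dP; last by rewrite gt_eqF.
  rewrite /ball_ /= sub0r normrN gtr0_norm//; lra.
rewrite g10 subr0 pmulr_rgt0 ?invr_gt0// => g1c.
have [|_] := eP t (sm t _); first by rewrite lexx (ltW t0).
apply/negP; rewrite -ltNge -subr_gt0 E mulr_gt0//.
Qed.

(** The quartic stands for a multiple of the barrier restricted to a line. *)
Lemma second_derivative_test_quartic (g g1 : R -> R) (d2 a1 a2 a3 a4 : R) :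
  (\forall t \near (0 : R), is_derive (t : R) 1 g (g1 t)) ->
  h^-1 * (g1 h - g1 0) @[h --> (0 : R)^'] --> d2 ->
  (\forall t \near (0 : R),
     g t + (a1 * t + a2 * t ^+ 2 + a3 * t ^+ 3 + a4 * t ^+ 4) <= g 0) ->
  g1 0 = - a1 /\ d2 + 2 * a2 <= 0.
Proof.
move=> dg dg1 gmax.
pose q (t : R) := a1 * t + a2 * t ^+ 2 + a3 * t ^+ 3 + a4 * t ^+ 4.
pose q1 (t : R) := a1 + 2 * a2 * t + 3 * a3 * t ^+ 2 + 4 * a4 * t ^+ 3.
have dq (t : R) : is_derive t 1 q (q1 t).
  rewrite /q /q1; apply: is_derive_eq.
  rewrite /GRing.scale /=; ring.
have [E L] : g1 0 + q1 0 = 0 /\ d2 + 2 * a2 <= 0.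
  apply: (@second_derivative_test (fun t => g t + q t) (fun t => g1 t + q1 t)).
  - by apply: filterS dg => t dgt; exact: is_deriveD.
  - have H : h^-1 * (g1 h - g1 0) + (2 * a2 + 3 * a3 * h + 4 * a4 * h ^+ 2)
       @[h --> (0 : R)^'] --> d2 + (2 * a2 + 3 * a3 * 0 + 4 * a4 * 0 ^+ 2).
      apply: cvgD => //.
      have H : (fun h : R => 2 * a2 + 3 * a3 * h + 4 * a4 * h ^+ 2) @ 0 --> 
         2 * a2 + 3 * a3 * 0 + 4 * a4 * 0 ^+ 2.
        apply: cvgD; first (apply: cvgD; first exact: cvg_cst).
          apply: cvgMl_tmp; exact: cvg_id.
        by apply: cvgMl_tmp; apply: exprn_continuous.
      by apply: cvg_trans H; apply: cvg_app; exact: nbhs_dnbhs.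
    rewrite expr0n /= !mulr0 !addr0 in H.
    apply: cvg_trans H; apply: near_eq_cvg; near=> h.
    have h0 : h != 0 by near: h; exact: nbhs_dnbhs_neq.
    by rewrite /q1; field.
  - apply: filterS gmax => t H.
    by have -> : g 0 + q 0 = g 0 by rewrite /q; ring.
split=> //; move: E; rewrite /q1 !expr0n /= !mulr0 !addr0.
by move/eqP; rewrite addr_eq0 => /eqP.
Unshelve. all: by end_near. Qed.
End SecondDerivativeTest.

(** * Hopf lemma and strong maximum principle *)

Section DotProduct.
Variables (R : realType) (m : nat).
Implicit Types a b c : 'rV[R]_m.

(** The flat product of the chart coordinates: the spheres of the barrier are Euclidean in the
    chart, whatever the metric is. *)
Definition dotv a b : R := \sum_k a 0 k * b 0 k.

Lemma dotvC a b : dotv a b = dotv b a.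
Proof. by apply: eq_bigr => k _; rewrite mulrC. Qed.

Lemma dotvDl a b c : dotv (a + b) c = dotv a c + dotv b c.
Proof. by rewrite -big_split; apply: eq_bigr => k _; rewrite mxE mulrDl. Qed.

Lemma dotvZl (t : R) a c : dotv (t *: a) c = t * dotv a c.
Proof. by rewrite mulr_sumr; apply: eq_bigr => k _; rewrite mxE mulrA. Qed.

Lemma dotvDr a b c : dotv c (a + b) = dotv c a + dotv c b.
Proof. by rewrite dotvC dotvDl !(dotvC c). Qed.

Lemma dotvNl a c : dotv (- a) c = - dotv a c.
Proof. by rewrite -scaleN1r dotvZl mulN1r. Qed.

Lemma dotvNr a c : dotv c (- a) = - dotv c a.
Proof. by rewrite dotvC dotvNl (dotvC c). Qed.

Lemma dotvBl a b c : dotv (a - b) c = dotv a c - dotv b c.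
Proof. by rewrite dotvDl dotvNl. Qed.

Lemma dotvZr (t : R) a c : dotv c (t *: a) = t * dotv c a.
Proof. by rewrite dotvC dotvZl (dotvC c). Qed.

Lemma dotv_ge0 a : 0 <= dotv a a.
Proof. by apply: sumr_ge0 => k _; rewrite -expr2 sqr_ge0. Qed.

Lemma dotv_ge_coord a k : (a 0 k) ^+ 2 <= dotv a a.
Proof.
rewrite /dotv (bigD1 k)//= -expr2 lerDl; apply: sumr_ge0 => j _.
by rewrite -expr2 sqr_ge0.
Qed.

Lemma dotv_delta a k : dotv a (delta_mx 0 k) = a 0 k.
Proof.
rewrite /dotv (bigD1 k)//= mxE !eqxx mulr1 big1 ?addr0// => j jk.
by rewrite mxE eqxx /= (negbTE jk) mulr0.
Qed.

Lemma dotv_mulmx a b : dotv a b = (a *m b^T) 0 0.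
Proof. by rewrite mxE; apply: eq_bigr => k _; rewrite mxE. Qed.

Lemma cvg_dotv (T : Type) (F : set_system T) (a b : T -> 'rV[R]_m) a0 b0 :
  Filter F -> (forall k, a t 0 k @[t --> F] --> a0 0 k) ->
  (forall k, b t 0 k @[t --> F] --> b0 0 k) ->
  dotv (a t) (b t) @[t --> F] --> dotv a0 b0.
Proof. by move=> FF ca cb; apply: cvg_sumr => k _; exact: cvgM. Qed.

End DotProduct.

Section Barrier.
Variables (R : realType) (m : nat) (d u0 : 'rV[R]_m) (K : R).
Implicit Types x c : 'rV[R]_m.

(* Positive exactly inside the sphere through [u0] centred at [u0 + d]. *)
Definition sphere_fun x : R := 2 * dotv d (x - u0) - dotv (x - u0) (x - u0).

(* A polynomial barrier: the square makes it a subsolution near [u0] for large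
   [K], the last term makes it negative on the sphere away from [u0]. *)
Definition barrier x : R :=
  sphere_fun x + K * sphere_fun x ^+ 2 - dotv (x - u0) (x - u0).

(** With [z = x - u0], [sphere_fun] has gradient [2 (d - z)] and Hessian [-2] times the identity,
    which gives this formula and the next. They are certified by [barrier_line] and not by computing
    partial derivatives. *)
Definition barrier_grad x : 'rV[R]_m :=
  (2 * (1 + 2 * K * sphere_fun x)) *: (d - (x - u0)) - 2 *: (x - u0).

Definition barrier_hess x : 'M[R]_m :=
  (8 * K) *: ((d - (x - u0))^T *m (d - (x - u0)))
  - (4 + 4 * K * sphere_fun x)%:M.

Lemma sphere_fun0 : sphere_fun u0 = 0.
Proof.
by rewrite /sphere_fun subrr /dotv !big1 ?mulr0 ?subrr// => k _; rewrite !mxE mulr0.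
Qed.

Lemma barrier0 : barrier u0 = 0.
Proof.
rewrite /barrier sphere_fun0 subrr /dotv !big1 ?expr0n ?mulr0 ?addr0 ?subrr//= => k _.
by rewrite !mxE mulr0.
Qed.

Lemma barrier_hess_inner x c :
  inner (barrier_hess x) c c =
  8 * K * dotv (d - (x - u0)) c ^+ 2 - (4 + 4 * K * sphere_fun x) * dotv c c.
Proof.
rewrite /barrier_hess innerDm innerZm inner_rank1 -dotv_mulmx dotvC.
rewrite -[X in inner X c c]scaleN1r.
rewrite innerZm mulN1r; congr (_ - _).
by rewrite /inner mul_mx_scalar -scalemxAl mxE -dotv_mulmx.
Qed.

Lemma barrier_line x c : exists a3 a4 : R, forall t : R,
  barrier (x + t *: c) = barrier x + (dotv (barrier_grad x) c * t +
    (inner (barrier_hess x) c c / 2) * t ^+ 2 + a3 * t ^+ 3 + a4 * t ^+ 4).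
Proof.
set e := dotv (d - (x - u0)) c; set n := dotv c c.
(* Both are coefficients of [K] times the square of [sphere_fun x + 2 t e - t^2 n], the only term of
   degree above two. *)
exists (- 4 * K * e * n), (K * n ^+ 2) => t.
rewrite barrier_hess_inner -/e -/n /barrier_grad dotvBl !dotvZl -/e.
have sE : sphere_fun (x + t *: c) = sphere_fun x + 2 * t * e - t ^+ 2 * n.
  rewrite /sphere_fun /e addrAC; move: (x - u0) => z.
  rewrite dotvBl !dotvDr !dotvDl !dotvZr !dotvZl -/n (dotvC c z); ring.
have zE : dotv (x + t *: c - u0) (x + t *: c - u0) =
    dotv (x - u0) (x - u0) + 2 * t * dotv (x - u0) c + t ^+ 2 * n.
  rewrite addrAC; move: (x - u0) => z.
  by rewrite !dotvDr !dotvDl !dotvZr !dotvZl -/n (dotvC c z); ring.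
by rewrite /barrier sE zE; field.
Qed.

Section Limits.
Variables (T : Type) (F : set_system T) (FF : Filter F) (y : T -> 'rV[R]_m).
Variable x : 'rV[R]_m.
Hypothesis cy : forall k, y t 0 k @[t --> F] --> x 0 k.

Lemma cvg_shift_coord k : (y t - u0) 0 k @[t --> F] --> (x - u0) 0 k.
Proof.
have E z : (z - u0) 0 k = z 0 k - u0 0 k by rewrite !mxE.
by rewrite E; under eq_cvg do rewrite E; apply: cvg_subr => //; exact: cvg_cst.
Qed.

Lemma cvg_sphere_fun : sphere_fun (y t) @[t --> F] --> sphere_fun x.
Proof.
have cz := cvg_shift_coord; apply: cvg_subr; last exact: cvg_dotv.
by apply: cvgMl_tmp; apply: cvg_dotv => // k; exact: cvg_cst.
Qed.

Lemma cvg_barrier : barrier (y t) @[t --> F] --> barrier x.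
Proof.
have cz := cvg_shift_coord; rewrite /barrier expr2; under eq_cvg do rewrite expr2.
apply: cvg_subr; last exact: cvg_dotv.
apply: cvg_addr; first exact: cvg_sphere_fun.
by apply: cvgMl_tmp; apply: cvg_mulr; exact: cvg_sphere_fun.
Qed.

Lemma cvg_barrier_grad k :
  barrier_grad (y t) 0 k @[t --> F] --> barrier_grad x 0 k.
Proof.
have E z : barrier_grad z 0 k =
    2 * (1 + 2 * K * sphere_fun z) * (d 0 k - (z - u0) 0 k) - 2 * (z - u0) 0 k.
  by rewrite /barrier_grad !mxE.
rewrite E; under eq_cvg do rewrite E.
have cz := @cvg_shift_coord k; have cs := cvg_sphere_fun.
apply: cvg_subr; last exact: cvgMl_tmp.
apply: cvg_mulr; last by apply: cvg_subr => //; exact: cvg_cst.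
by apply: cvgMl_tmp; apply: cvg_addr; [exact: cvg_cst|exact: cvgMl_tmp].
Qed.

Lemma cvg_barrier_hess k l :
  barrier_hess (y t) k l @[t --> F] --> barrier_hess x k l.
Proof.
have E z : barrier_hess z k l =
    8 * K * ((d 0 k - (z - u0) 0 k) * (d 0 l - (z - u0) 0 l)) -
    (4 + 4 * K * sphere_fun z) * (k == l)%:R.
  by rewrite /barrier_hess !mxE big_ord1 !mxE -[X in _ - X]mulr_natr.
rewrite E; under eq_cvg do rewrite E.
have cz := cvg_shift_coord; have cs := cvg_sphere_fun.
apply: cvg_subr.
  by apply: cvgMl_tmp; apply: cvg_mulr; apply: cvg_subr => //; exact: cvg_cst.
by apply: cvgMr_tmp; apply: cvg_addr; [exact: cvg_cst|exact: cvgMl_tmp].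
Qed.
End Limits.

Lemma sphere_fun_continuous : continuous sphere_fun.
Proof.
move=> x; apply: (@cvg_sphere_fun _ (nbhs x) (nbhs_filter x) id) => k.
exact: coord_continuous.
Qed.

End Barrier.

Definition grad (R : realType) (m : nat) (A : set 'rV[R]_m) (f : 'rV[R]_m -> R)
  (x : 'rV[R]_m) : 'rV[R]_m := \row_k pderiv A k f x.

Definition hess (R : realType) (m : nat) (A : set 'rV[R]_m) (f : 'rV[R]_m -> R)
  (x : 'rV[R]_m) : 'M[R]_m := \matrix_(k, l) pderiv A k (pderiv A l f) x.

Lemma Ck_onS (R : realType) (m : nat) (A : set 'rV[R]_m) r (f : 'rV[R]_m -> R) :
  Ck_on A r.+1 f -> Ck_on A r f.
Proof.
elim: r f => [|r IH] f; first by move=> [].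
by move=> [cf df]; split=> // k; have [? ?] := df k; split=> //; exact: IH.
Qed.

Lemma coord_cvg_within (R : realType) (m : nat) (A : set 'rV[R]_m) (u : 'rV[R]_m) k :
  (x : 'rV[R]_m) 0 k @[x --> within A (nbhs u)] --> u 0 k.
Proof.
move=> Q /(@coord_continuous R 1 m 0 k u) HQ.
exact: (@cvg_within _ (nbhs u) (nbhs_filter u) A _ HQ).
Qed.

Section Hopf.
Variables (R : realType) (m : nat) (P : pred 'I_m) (D : set 'rV[R]_m).
Hypothesis oD : orthant_open P D.
Variables (f : 'rV[R]_m -> R).
Hypothesis C2f : Ck_on D 2 f.

Definition interior_pt (x : 'rV[R]_m) := forall k, P k -> 0 < x 0 k.

Lemma near_interior x : D x -> interior_pt x ->
  \forall y \near x, D y /\ interior_pt y.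
Proof.
move=> Dx ix; have [_ /(_ x Dx) nD] := oD.
have H k : \forall y \near x, P k -> 0 < (y : 'rV[R]_m) 0 k.
  have [Pk|nPk] := boolP (P k); last by apply: (@filterE _ (nbhs x) (nbhs_filter x)) => y.
  have := @cvgr_gt R _ (nbhs x) (nbhs_filter x) (fun y : 'rV[R]_m => y 0 k)
    (x 0 k) (@coord_continuous R 1 m 0 k x) 0 (ix k Pk).
  by apply: filterS => y.
have H' := @filter_forall _ _ _ (nbhs x) (nbhs_filter x) H.
apply: filterS2 nD H' => y yD iy; split=> [|k]; last exact: iy.
by apply: yD => k /(iy k)/ltW.
Qed.

(** Increasing all constrained coordinates at once by a small amount leaves the boundary. This gives
    access to the interior, where the elliptic inequality is available. *)
Lemma interior_dense x (B : 'rV[R]_m -> Prop) : D x ->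
  (\forall y \near x, D y -> B y) -> exists y, [/\ D y, interior_pt y & B y].
Proof.
move=> Dx nB; have [_ /(_ x Dx) nD] := oD.
have /nbhs_rowP[e e0 eP] := @filterI _ (nbhs x) (nbhs_filter x) _ _ nB nD.
pose y : 'rV[R]_m := x + (e / 2) *: \row_k (P k)%:R.
have yE k : y 0 k = x 0 k + e / 2 * (P k)%:R by rewrite !mxE.
have iy : interior_pt y.
  move=> k Pk; rewrite yE Pk mulr1 ltr_wpDl ?divr_gt0//; exact: oD.1 Pk.
have [|By Dy] := eP y.
  move=> k; rewrite yE addrAC subrr add0r normrM ger0_norm; last by rewrite divr_ge0// ltW.
  by case: (P k); rewrite ?normr1 ?normr0; lra.
have {}Dy : D y by apply: Dy => k /iy/ltW.
by exists y; split=> //; exact: By.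
Qed.

Lemma line_max x (c : 'rV[R]_m) (a1 a2 a3 a4 : R) : D x -> interior_pt x ->
  (\forall t \near (0 : R), f (x + t *: c) +
     (a1 * t + a2 * t ^+ 2 + a3 * t ^+ 3 + a4 * t ^+ 4) <= f x) ->
  dotv (grad D f x) c = - a1 /\ inner (hess D f x) c c + 2 * a2 <= 0.
Proof.
move=> Dx ix fmax.
have x0 : x + 0 *: c = x by rewrite scale0r addr0.
have nI : \forall t \near (0 : R), D (x + t *: c) /\ interior_pt (x + t *: c).
  have := @line_continuous R m x c 0.
  by rewrite x0 => /(_ _ (near_interior Dx ix)).
have chain (u : 'rV[R]_m -> R) y : Ck_on D 1 u -> D y -> interior_pt y ->
    h^-1 * (u (y + h *: c) - u y) @[h --> (0 : R)^'] --> \sum_k pderiv D k u y * c 0 k.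
  move=> Cu Dy iy; apply: (chain_rule oD Cu Dy).
    apply: nbhs_dnbhs; have := @line_continuous R m y c 0.
    rewrite scale0r addr0 => /(_ _ (near_interior Dy iy)).
    by apply: filterS => h [].
  move=> k; have : c 0 k @[h --> (0 : R)^'] --> c 0 k by exact: cvg_cst.
  apply: cvg_trans; apply: near_eq_cvg; near=> h.
  have h0 : h != 0 by near: h; exact: nbhs_dnbhs_neq.
  by rewrite !mxE addrAC subrr add0r mulKf.
pose g1 (t : R) := dotv (grad D f (x + t *: c)) c.
have gx : g1 0 = dotv (grad D f x) c by rewrite /g1 x0.
rewrite -gx.
apply: (@second_derivative_test_quartic R (fun t : R => f (x + t *: c)) g1 _ a1 a2 a3 a4).
- apply: filterS nI => t [Dt it]; apply: is_derive_quot.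
  have E : \sum_k pderiv D k f (x + t *: c) * c 0 k = g1 t.
    by apply: eq_bigr => k _; rewrite mxE.
  have := chain f _ (Ck_onS C2f) Dt it; rewrite E.
  apply: cvg_trans; apply: near_eq_cvg; apply: nearW => h.
  by rewrite -addrA scalerDl.
- have [_ df] := C2f.
  have : \sum_l (h^-1 * (pderiv D l f (x + h *: c) - pderiv D l f x)) * c 0 l
      @[h --> (0 : R)^'] --> \sum_l (\sum_k pderiv D k (pderiv D l f) x * c 0 k) * c 0 l.
    apply: cvg_sumr => l _; apply: cvgMr_tmp; apply: chain => //.
    by have [] := df l.
  have -> : \sum_l (\sum_k pderiv D k (pderiv D l f) x * c 0 k) * c 0 l =
      inner (hess D f x) c c.
    rewrite innerE exchange_big /=; apply: eq_bigr => l _.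
    by rewrite mulr_suml; apply: eq_bigr => k _; rewrite mxE; ring.
  apply: cvg_trans; apply: near_eq_cvg; apply: nearW => h.
  rewrite /g1 /dotv x0 -sumrB mulr_sumr; apply: eq_bigr => l _.
  by rewrite !mxE; ring.
- by rewrite /= x0.
Unshelve. all: by end_near. Qed.

Variables (Gam : 'rV[R]_m -> 'M[R]_m) (b : 'rV[R]_m -> 'rV[R]_m).
Hypothesis Gam_posdef : forall x, D x -> posdef (Gam x).
Hypothesis subsol : forall x, D x -> interior_pt x ->
  0 <= \tr (Gam x *m hess D f x) + dotv (b x) (grad D f x).

Definition barrier_op d u0 K x : R :=
  \tr (Gam x *m barrier_hess d u0 K x) + dotv (b x) (barrier_grad d u0 K x).

(** At such a maximum the sum has zero gradient and a nonpositive Hessian, so the operator, which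
    has no term of order zero, is nonpositive on it by [posdef_tr_le0]. But it is nonnegative on [f]
    and positive on the barrier. *)
Lemma no_local_max d u0 K e x : D x -> interior_pt x -> 0 < e ->
  0 < barrier_op d u0 K x ->
  ~ \forall y \near x,
      f y + e * barrier d u0 K y <= f x + e * barrier d u0 K x.
Proof.
move=> Dx ix e0 Lx xmax.
have cond c : dotv (grad D f x) c = - (e * dotv (barrier_grad d u0 K x) c) /\
    inner (hess D f x) c c + e * inner (barrier_hess d u0 K x) c c <= 0.
  have [a3 [a4 bl]] := barrier_line d u0 K x c.
  have := @line_max x c (e * dotv (barrier_grad d u0 K x) c)
    (e * (inner (barrier_hess d u0 K x) c c / 2)) (e * a3) (e * a4) Dx ix.
  have -> : 2 * (e * (inner (barrier_hess d u0 K x) c c / 2)) =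
    e * inner (barrier_hess d u0 K x) c c by field.
  apply; have H : \forall t \near (0 : R), f (x + t *: c) +
      e * barrier d u0 K (x + t *: c) <= f x + e * barrier d u0 K x.
    by have := @line_continuous R m x c 0; rewrite scale0r addr0 => /(_ _ xmax).
  by apply: filterS H => t; rewrite bl; lra.
have gE : grad D f x = - e *: barrier_grad d u0 K x.
  by apply/rowP => k; rewrite -dotv_delta (cond _).1 dotv_delta [RHS]mxE mulNr.
have tr0 : \tr (Gam x *m (hess D f x + e *: barrier_hess d u0 K x)) <= 0.
  apply: posdef_tr_le0; first exact: Gam_posdef.
  by move=> c; rewrite innerDm innerZm; exact: (cond c).2.
have := subsol Dx ix; rewrite gE dotvZr.
move: tr0; rewrite mulmxDr mxtraceD -scalemxAr mxtraceZ.
move: Lx; rewrite /barrier_op => Lx tr0 s0.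
have : 0 < e * (\tr (Gam x *m barrier_hess d u0 K x) +
  dotv (b x) (barrier_grad d u0 K x)) by rewrite mulr_gt0.
by rewrite mulrDr; lra.
Qed.

Variables (u0 d : 'rV[R]_m).
Hypotheses (Du0 : D u0) (d_neq0 : d != 0).
Hypothesis Gam_cvg : forall k l, Gam x k l @[x --> within D (nbhs u0)] --> Gam u0 k l.
Hypothesis b_cvg : forall k, b x 0 k @[x --> within D (nbhs u0)] --> b u0 0 k.

Lemma barrier_op_gt0 : exists2 K, 0 < K &
  0 < barrier_op d u0 K u0 /\
  \forall x \near u0, D x -> 0 < barrier_op d u0 K x.
Proof.
have g0 : 0 < inner (Gam u0) d d by apply: (Gam_posdef Du0).2.
(* At [u0] the barrier has gradient [2 d] and Hessian [8 K d^T d - 4], so the operator takes the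
   value [8 K <Gam d, d> - t] there; [K] is chosen to make it [|t| + 1 - t]. *)
pose t := 4 * \tr (Gam u0) - 2 * dotv (b u0) d.
pose K := (`|t| + 1) / (8 * inner (Gam u0) d d).
have K0 : 0 < K by rewrite divr_gt0 ?mulr_gt0// ltr_wpDl.
have L0 : 0 < barrier_op d u0 K u0.
  rewrite /barrier_op /barrier_hess /barrier_grad sphere_fun0 subrr !subr0 !mulr0 !addr0.
  rewrite mulmxBr -scalemxAr mul_mx_scalar raddfB /= !mxtraceZ.
  rewrite mulmxA mxtrace_mulC mulmxA [\tr _]trace_mx11 -/(inner _ _ _).
  rewrite scaler0 subr0 mulr1 dotvZr.
  have -> : 8 * K * inner (Gam u0) d d = `|t| + 1.
    by rewrite /K; field; rewrite gt_eqF.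
  have := ler_norm t; rewrite /t; lra.
exists K => //; split=> //.
suff H : barrier_op d u0 K x @[x --> within D (nbhs u0)] --> barrier_op d u0 K u0.
  exact: (cvgr_gt (barrier_op d u0 K u0) H 0 L0).
have cx := @coord_cvg_within R m D u0.
rewrite /barrier_op /mxtrace; apply: cvg_addr.
  apply: cvg_sumr => k _; rewrite mxE; under eq_cvg do rewrite mxE.
  apply: cvg_sumr => l _; apply: cvg_mulr => //.
  exact: (@cvg_barrier_hess _ _ _ _ _ _ _ _ id).
apply: cvg_dotv => // k.
exact: (@cvg_barrier_grad _ _ _ _ _ _ _ _ id).
Qed.

(* Compare [f] with [mx - e * barrier] on the part in the orthant of a small cube
   centred at [u0]. *)
Lemma hopf_lemma mx : f u0 = mx ->
  (\forall x \near u0, D x -> f x <= mx) ->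
  (\forall x \near u0, D x -> 0 < sphere_fun d u0 x -> f x < mx) ->
  (\forall x \near u0, D x -> ~ interior_pt x -> sphere_fun d u0 x <= 0) ->
  ~ interior_pt u0 /\
  exists K e, 0 < e /\ \forall x \near u0, D x -> f x <= mx - e * barrier d u0 K x.
Proof.
move=> fu0 fle flt fbd.
have [K K0 [L0 Ln]] := barrier_op_gt0.
(* Writing [s] for [sphere_fun], this gives [s + K s^2 = s (1 + K s)] the sign of [s], with a second
   factor below 2. *)
have sK : \forall x \near u0, `|K * sphere_fun d u0 x| < 1.
  have H : K * sphere_fun d u0 x @[x --> u0] --> K * sphere_fun d u0 u0.
    by apply: (@cvgMl_tmp _ _ _ (nbhs_filter u0)); exact: sphere_fun_continuous.
  rewrite sphere_fun0 mulr0 in H.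
  have := @cvgr0_norm_lt _ _ _ _ (nbhs_filter u0) _ H 1 ltr01.
  exact.
have nD := oD.2 _ Du0.
have [r r0 rP] : exists2 r : R, 0 < r & forall x : 'rV[R]_m,
    (forall k, `|x 0 k - u0 0 k| < r) -> @orthant R m P x ->
    [/\ D x, f x <= mx, 0 < sphere_fun d u0 x -> f x < mx,
        ~ interior_pt x -> sphere_fun d u0 x <= 0 &
        0 < barrier_op d u0 K x /\ `|K * sphere_fun d u0 x| < 1].
  pose I := @filterI _ (nbhs u0) (nbhs_filter u0).
  apply/nbhs_rowP; have H1 := I _ _ fle (I _ _ flt (I _ _ fbd (I _ _ Ln (I _ _ sK nD)))).
  apply: filterS H1 => x [h1 [h2 [h3 [h4 [h5 h6]]]]] ox.
  by have Dx := h6 ox; split; auto.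
pose de := r / 2; have de0 : 0 < de by rewrite divr_gt0.
(* Constrained sides are cut off at 0, so that the part of the cube in the orthant is again a
   product of segments, hence compact. *)
pose side k : set R :=
  `[Num.max (if P k then 0 else u0 0 k - de) (u0 0 k - de), u0 0 k + de]%classic.
pose box := [set x : 'rV[R]_m | forall k, side k (x 0 k)].
have boxP x : box x <-> @orthant R m P x /\ forall k, `|x 0 k - u0 0 k| <= de.
  split=> [bx|[ox xu] k].
    split=> k; have := bx k; rewrite /side /= in_itv /= ge_max => /andP[/andP[h1 h2] h3].
      by move=> Pk; move: h1; rewrite Pk.
    by rewrite ler_norml; apply/andP; split; lra.
  have := xu k; rewrite ler_norml /side /= in_itv /= ge_max => /andP[h1 h2].
  apply/andP; split; last lra; apply/andP; split; last lra.
  by have [Pk|nPk] := boolP (P k); [exact: ox|lra].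
have cbox : compact box.
  by apply: (@rV_compact R m side) => k; exact: segment_compact.
have boxr x : box x -> [/\ D x, f x <= mx, 0 < sphere_fun d u0 x -> f x < mx,
        ~ interior_pt x -> sphere_fun d u0 x <= 0 &
        0 < barrier_op d u0 K x /\ `|K * sphere_fun d u0 x| < 1].
  move=> /boxP[ox xu]; apply: rP => // k; apply: le_lt_trans (xu k) _.
  by rewrite /de; lra.
have boxu0 : box u0.
  apply/boxP; split; first exact: oD.1.
  by move=> k; rewrite subrr normr0 ltW.
have cf : {within box, continuous f}.
  by apply: continuous_subspaceW C2f.1 => x /boxr[].
(* On a face of the cube the squared distance to [u0] is at least [de^2], so the barrier is at most
   [s (1 + K s) - de^2] with [s] the value of [sphere_fun]. It is therefore positive only where
   [s >= de^2 / 2]; on that compact set [f] stays below [mx] by a gap [eta]. *)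
pose inner_box := box `&` [set x | de ^+ 2 / 2 <= sphere_fun d u0 x].
have cin : compact inner_box.
  apply: compact_closedI => //.
  apply: (@preimage_closed _ _ (sphere_fun d u0) [set s : R | de ^+ 2 / 2 <= s]).
    by move=> x _; exact: sphere_fun_continuous.
  exact: closed_ge.
have [eta eta0 etaP] : exists2 eta : R, 0 < eta &
    forall x, inner_box x -> f x <= mx - eta.
  have [[x0 ix0]|nix] := pselect (inner_box !=set0); last first.
    by exists 1 => // x ix; exfalso; apply: nix; exists x.
  have cfi : {within inner_box, continuous f}.
    by apply: continuous_subspaceW cf => x [].
  have [c ci cmax] := @EVT_max_rV _ _ f inner_box (ex_intro _ x0 ix0) cin cfi.
  have [/boxr [_ _ clt _ _] cs] := set_mem ci.
  exists (mx - f c).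
    by rewrite subr_gt0 clt// (lt_le_trans _ cs)// divr_gt0// exprn_gt0.
  by move=> x ix; rewrite opprB addrC subrK; apply: cmax; exact: mem_set.
(* As [|K s| < 1], [K] times the barrier is at most 2, so [e] times the barrier does not exceed the
   gap [eta]. *)
pose e := eta * K / 2; have e0 : 0 < e by rewrite divr_gt0// mulr_gt0.
pose w x := f x + e * barrier d u0 K x.
have bneg x : `|K * sphere_fun d u0 x| < 1 -> sphere_fun d u0 x <= 0 ->
    barrier d u0 K x <= 0.
  rewrite ltr_norml => /andP[s1 s2] s0; have := dotv_ge0 (x - u0).
  rewrite /barrier expr2; nra.
have wle x : box x -> f x + e * barrier d u0 K x <= mx.
  have cw : {within box, continuous w}.
    apply/subspace_continuousP => y By; apply: cvg_addr.
      by move/subspace_continuousP : cf; exact.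
    apply: cvgMl_tmp; apply: (@cvg_barrier _ _ _ _ _ _ _ _ id) => k.
    exact: coord_cvg_within.
  have [z zb zmax] := @EVT_max_rV _ _ w box (ex_intro _ u0 boxu0) cbox cw.
  move=> bx; apply: le_trans (zmax x (mem_set bx)) _.
  move/set_mem : zb => {x bx} zb; have [Dz fz fz' zbd [Lz sz]] := boxr _ zb.
  (* At a maximum [z] of [w] outside the interior of the orthant the barrier is nonpositive; on a
     face of the cube it is nonpositive or absorbed by [eta]; anywhere else [no_local_max] excludes
     [z]. *)
  have [iz|/zbd sz0] := pselect (interior_pt z); last first.
    have := bneg _ sz sz0; rewrite /w; nra.
  have [[k kz]|nbd] := pselect (exists k, `|z 0 k - u0 0 k| = de).
    have zz : de ^+ 2 <= dotv (z - u0) (z - u0).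
      apply: le_trans (dotv_ge_coord _ k); rewrite !mxE -kz real_normK//.
      exact: num_real.
    move: sz; rewrite ltr_norml => /andP[s1 s2].
    have [s0|s0] := leP (sphere_fun d u0 z) 0.
      have : barrier d u0 K z <= 0 by apply: bneg => //; rewrite ltr_norml s1.
      rewrite /w; nra.
    have [si|si] := leP (de ^+ 2 / 2) (sphere_fun d u0 z); last first.
      have : barrier d u0 K z <= 0 by rewrite /barrier expr2; nra.
      rewrite /w; nra.
    have fe : f z <= mx - eta by apply: etaP; split.
    have be : K * barrier d u0 K z <= 2 by rewrite /barrier expr2; nra.
    rewrite /w /e; nra.
  exfalso; apply: (no_local_max Dz iz e0 Lz).
  have zi k : `|z 0 k - u0 0 k| < de.
    have [_ zu] := (boxP z).1 zb; rewrite lt_neqAle zu andbT.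
    by apply/eqP => kz; apply: nbd; exists k.
  have nz k : \forall y \near z, `|(y : 'rV[R]_m) 0 k - u0 0 k| < de.
    have kz : 0 < de - `|z 0 k - u0 0 k| by rewrite subr_gt0.
    apply/nbhs_rowP; exists (de - `|z 0 k - u0 0 k|) => // y yz.
    have := ler_normD (y 0 k - z 0 k) (z 0 k - u0 0 k).
    by have := yz k; rewrite addrA subrK; lra.
  have H := @filterI _ (nbhs z) (nbhs_filter z) _ _ (near_interior Dz iz)
    (@filter_forall _ _ _ (nbhs z) (nbhs_filter z) nz).
  apply: filterS H => y [[Dy iy] yu]; apply: zmax; apply/mem_set/boxP; split.
    exact: oD.1.
  by move=> k; exact: ltW.
have wn : \forall x \near u0, D x -> f x + e * barrier d u0 K x <= mx.
  apply/nbhs_rowP; exists de => // x xu Dx; apply: wle; apply/boxP; split.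
    exact: oD.1.
  by move=> k; exact: ltW.
split; last first.
  by exists K, e; split=> //; apply: filterS wn => x H /H; lra.
(* The barrier vanishes at [u0], so by [wn] the sum would have a local maximum at [u0] itself. *)
move=> iu; apply: (no_local_max Du0 iu e0 L0).
have := @filterI _ (nbhs u0) (nbhs_filter u0) _ _ (near_interior Du0 iu) wn.
apply: filterS => x [[Dx _] /(_ Dx)].
by rewrite barrier0 mulr0 addr0 fu0.
Qed.
End Hopf.

Section StrongMaximum.
Variables (R : realType) (m : nat) (P : pred 'I_m) (D : set 'rV[R]_m).
Hypothesis oD : orthant_open P D.
Variables (f : 'rV[R]_m -> R).
Hypothesis C2f : Ck_on D 2 f.
Variables (Gam : 'rV[R]_m -> 'M[R]_m) (b : 'rV[R]_m -> 'rV[R]_m).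
Hypothesis Gam_posdef : forall x, D x -> posdef (Gam x).
Hypothesis subsol : forall x, D x -> interior_pt P x ->
  0 <= \tr (Gam x *m hess D f x) + dotv (b x) (grad D f x).
Hypothesis Gam_cvg : forall u, D u -> forall k l,
  Gam x k l @[x --> within D (nbhs u)] --> Gam u k l.
Hypothesis b_cvg : forall u, D u -> forall k,
  b x 0 k @[x --> within D (nbhs u)] --> b u 0 k.

Lemma interior_continuous x : D x -> interior_pt P x -> f @ x --> f x.
Proof.
move=> Dx ix Q fQ; have /subspace_continuousP/(_ x Dx Q fQ) H := C2f.1.
have {}H : \forall y \near x, D y -> Q (f y) by exact: H.
by apply: filterS2 H (near_interior oD Dx ix) => y h [Dy _]; exact: h.
Qed.

(* Otherwise some sphere centred near [u] at a point where [f < mx] touches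
   [f = mx] from inside, which contradicts Hopf's lemma. *)
Lemma strong_maximum u mx : D u -> interior_pt P u -> f u = mx ->
  (\forall x \near u, D x -> f x <= mx) -> \forall x \near u, f x = mx.
Proof.
move=> Du iu fu fle.
have [r r0 rP] : exists2 r : R, 0 < r & forall x : 'rV[R]_m,
    (forall k, `|x 0 k - u 0 k| < r) -> [/\ D x, interior_pt P x & f x <= mx].
  apply/nbhs_rowP; apply: filterS2 fle (near_interior oD Du iu) => x h [Dx ix].
  by split=> //; exact: h.
pose rho := r / 2; have rho0 : 0 < rho by rewrite divr_gt0.
(* A maximum point nearest to such an [x] is no farther from it than [u], so it lies within [rho] of
   [u], strictly inside the cube. *)
have nu : \forall x \near u, dotv (u - x) (u - x) < (rho / 2) ^+ 2.
  have H : dotv (u - x) (u - x) @[x --> u] --> dotv (u - u) (u - u).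
    have H k : (u - x) 0 k @[x --> u] --> (u - u) 0 k.
      apply: (@cvg_coord R _ (nbhs u) m (fun y => u - y) _ k (nbhs_filter u)).
      by apply: cvgB; [exact: cvg_cst|exact: cvg_id].
    exact: (@cvg_dotv R m _ (nbhs u) _ _ _ _ (nbhs_filter u)).
  apply: (@cvgr_lt R _ (nbhs u) (nbhs_filter u) _ _ H).
  rewrite subrr /dotv big1 ?exprn_gt0 ?divr_gt0// => k _.
  by rewrite mxE mulr0.
have nr : \forall x \near u, forall k, `|(x : 'rV[R]_m) 0 k - u 0 k| < r.
  by apply/nbhs_rowP; exists r.
apply: filterS2 nu nr => x1 x1u x1r.
have [Dx1 ix1] := rP _ x1r; rewrite le_eqVlt => /orP[/eqP //|fx1].
exfalso.
pose side k : set R := `[u 0 k - rho, u 0 k + rho]%classic.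
pose box := [set x : 'rV[R]_m | forall k, side k (x 0 k)].
have boxP x : box x <-> forall k, `|x 0 k - u 0 k| <= rho.
  by split=> bx k; move: (bx k); rewrite /side /= in_itv /= ler_distlC => /andP[? ?];
    apply/andP; split; lra.
have cbox : compact box.
  by apply: (@rV_compact R m side) => k; exact: segment_compact.
have boxr x : box x -> [/\ D x, interior_pt P x & f x <= mx].
  move=> /boxP xu; apply: rP => k; apply: le_lt_trans (xu k) _.
  by rewrite /rho; lra.
pose Z := box `&` [set x | f x = mx].
have clZ : closed Z.
  move=> z clz.
  have bz : box z.
    have clb : closed box by apply: compact_closed => //; exact: norm_hausdorff.
    by apply: clb => B /clz [y [[by_ _] By]]; exists y.
  split=> //=; have [Dz iz] := boxr _ bz; rewrite le_eqVlt => /orP[/eqP //|fz].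
  have nz : \forall y \near z, f y < mx.
    by apply: (@cvgr_lt R _ (nbhs z) (nbhs_filter z) _ _ (interior_continuous Dz iz)).
  by have [y [[_ /= ->]]] := clz _ nz; rewrite /= ltxx.
have cZ : compact Z by apply: (subclosed_compact clZ cbox) => x [].
have Zu : Z u.
  by split=> //; apply/boxP => k; rewrite subrr normr0 ltW.
pose q x := dotv (x - x1) (x - x1).
have cq : {within Z, continuous q}.
  apply/subspace_continuousP => y _; apply: cvg_dotv => k;
    apply: (@cvg_shift_coord _ _ _ _ _ _ id) => j; exact: coord_cvg_within.
(* [z] is a maximum point nearest to [x1]: the ball centred at [x1] with [z] on its sphere contains
   no maximum point of the cube, and [sE] identifies it with the ball of [sphere_fun] for
   [d = x1 - z]. *)
have [z /set_mem [bz fz] zmin] := @EVT_min_rV _ _ q Z (ex_intro _ u Zu) cZ cq.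
have [Dz iz _] := boxr _ bz.
have qz : q z < (rho / 2) ^+ 2 by apply: le_lt_trans (zmin u (mem_set Zu)) _.
have zu k : `|z 0 k - u 0 k| < rho.
  have h2 : 0 <= rho / 2 by rewrite divr_ge0// ltW.
  have h1 (y : 'rV[R]_m) : dotv y y < (rho / 2) ^+ 2 -> `|y 0 k| < rho / 2.
    move=> yr; rewrite -ltr_sqr ?nnegrE// real_normK ?num_real//.
    exact: le_lt_trans (dotv_ge_coord _ _) yr.
  have := h1 _ qz; have := h1 _ x1u; rewrite !mxE => hu hz.
  have := ler_normB (z 0 k - x1 0 k) (u 0 k - x1 0 k).
  by rewrite opprB addrA subrK; lra.
pose d := x1 - z.
have d0 : d != 0 by rewrite subr_eq0; apply: contraTneq fx1 => ->; rewrite fz ltxx.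
have nbox : \forall x \near z, box x.
  have nz k : \forall y \near z, `|(y : 'rV[R]_m) 0 k - u 0 k| < rho.
    apply/nbhs_rowP; exists (rho - `|z 0 k - u 0 k|); first by rewrite subr_gt0.
    move=> y yz; have := ler_normD (y 0 k - z 0 k) (z 0 k - u 0 k).
    by have := yz k; rewrite addrA subrK; lra.
  have H := @filter_forall _ _ _ (nbhs z) (nbhs_filter z) nz.
  by apply: filterS H => y yu; apply/boxP => k; exact: ltW.
have sE x : sphere_fun d z x = q z - q x.
  rewrite /sphere_fun /q /d.
  have -> : x - x1 = (x - z) + (z - x1) by rewrite addrA subrK.
  rewrite -(opprB x1 z); move: (x1 - z) => a; move: (x - z) => c.
  rewrite !dotvDl !dotvDr !dotvNl !dotvNr (dotvC c a); ring.
have [] := hopf_lemma oD C2f Gam_posdef subsol Dz d0 (Gam_cvg Dz) (b_cvg Dz) fz.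
- by apply: filterS nbox => x /boxr[].
- apply: filterS nbox => x bx _; rewrite sE subr_gt0 => qx.
  have [_ _] := boxr _ bx; rewrite le_eqVlt => /orP[/eqP fx|//].
  have Zx : Z x by split.
  by have := zmin x (mem_set Zx); rewrite leNgt qx.
- by apply: filterS (near_interior oD Dz iz) => x [_ ix] _.
- by move=> /(_ iz).
Qed.
End StrongMaximum.

(** * The height of a hypersurface in local coordinates *)

Local Notation jac := Defs.jacobian.

Section LoweredChristoffel.
Variables (R : realType) (m : nat) (A : set 'rV[R]_m) (G : 'rV[R]_m -> 'M[R]_m).
Variable y : 'rV[R]_m.
Hypothesis Gp : posdef (G y).

(** The Christoffel symbols of the first kind. *)
Definition lower_christoffel (i j l : 'I_m) : R :=
  2^-1 * (pderiv A i (fun z => G z j l) y + pderiv A j (fun z => G z i l) y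
          - pderiv A l (fun z => G z i j) y).

Lemma sum_invmx_posdef (p : 'I_m -> R) l :
  \sum_k (\sum_q invmx (G y) k q * p q) * G y k l = p l.
Proof.
have Gu := posdef_unit Gp; have [Gs _] := Gp.
have GG q : \sum_k invmx (G y) k q * G y k l = (q == l)%:R.
  have := congr1 (fun M : 'M[R]_m => M q l) (mulVmx Gu).
  rewrite !mxE => <-; apply: eq_bigr => k _; congr (_ * _).
  by rewrite -[in LHS]Gs -trmx_inv mxE.
under eq_bigr do rewrite mulr_suml.
rewrite exchange_big /=.
under eq_bigr => q _.
  under eq_bigr do rewrite mulrAC.
  rewrite -mulr_suml GG.
  over.
by rewrite (bigD1 l)//= eqxx mul1r big1 ?addr0// => q /negbTE ->; rewrite mul0r.
Qed.

Lemma christoffel_lower i j l :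
  \sum_k christoffel A G y i j k * G y k l = lower_christoffel i j l.
Proof.
pose T q := pderiv A i (fun z => G z j q) y + pderiv A j (fun z => G z i q) y
  - pderiv A q (fun z => G z i j) y.
rewrite /lower_christoffel -/(T l) -(sum_invmx_posdef T l) mulr_sumr.
by apply: eq_bigr => k _; rewrite mulrA.
Qed.

Lemma inner_gradient (psi : 'rV[R]_m -> R) w :
  inner (G y) (gradient A G psi y) w = \sum_l pderiv A l psi y * w 0 l.
Proof.
rewrite innerE exchange_big /=; apply: eq_bigr => l _.
rewrite -mulr_suml -[in RHS](sum_invmx_posdef (fun q => pderiv A q psi y) l).
by congr (_ * _); apply: eq_bigr => k _; rewrite mxE.
Qed.

Definition christoffel_form (u v w : 'rV[R]_m) : R :=
  \sum_i \sum_j \sum_l lower_christoffel i j l * u 0 i * v 0 j * w 0 l.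

Lemma inner_cov_deriv (n : nat) (D : set 'rV[R]_n) (Y W : 'rV[R]_n -> 'rV[R]_m) a u w :
  Y u = y ->
  inner (G (Y u)) (cov_deriv A G D Y W a u) w =
  inner (G y) (row a (jac D W u)) w +
  christoffel_form (row a (jac D Y u)) (W u) w.
Proof.
move=> Yy; rewrite Yy.
have -> : cov_deriv A G D Y W a u = row a (jac D W u) +
    \row_k \sum_i \sum_j christoffel A G y i j k * jac D Y u a i * W u 0 j.
  by apply/rowP => k; rewrite !mxE Yy.
rewrite innerDl; congr (_ + _); rewrite innerE /christoffel_form.
under eq_bigr => k _ do under eq_bigr => l _ do rewrite mxE !mulr_suml.
under eq_bigr => k _ do rewrite exchange_big /=.
rewrite exchange_big /=; apply: eq_bigr => i _.
under eq_bigr => k _ do under eq_bigr => l _ do rewrite !mulr_suml.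
under eq_bigr => k _ do rewrite exchange_big /=.
rewrite exchange_big /=; apply: eq_bigr => j _.
rewrite exchange_big /=; apply: eq_bigr => l _.
rewrite -christoffel_lower !mulr_suml; apply: eq_bigr => k _.
by rewrite !mxE; ring.
Qed.

(** Compatibility of the connection with the metric: the symbols of the first kind for [(i, j, l)]
    and [(i, l, j)] add up to the derivative of [G j l] in direction [i]. *)
Lemma christoffel_form_compat (u v w : 'rV[R]_m) :
  (forall i j l, pderiv A i (fun z => G z j l) y = pderiv A i (fun z => G z l j) y) ->
  christoffel_form u v w + christoffel_form u w v =
  \sum_j \sum_l (\sum_i pderiv A i (fun z => G z j l) y * u 0 i) * v 0 j * w 0 l.
Proof.
move=> dGs; rewrite /christoffel_form -big_split /=.
under [in RHS]eq_bigr => j _ do under eq_bigr => l _ do rewrite !mulr_suml.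
under [in RHS]eq_bigr => j _ do rewrite exchange_big /=.
rewrite [in RHS]exchange_big /=; apply: eq_bigr => i _.
rewrite [X in _ + X]exchange_big -big_split /=; apply: eq_bigr => j _.
rewrite -big_split /=; apply: eq_bigr => l _.
rewrite /lower_christoffel (dGs j i l) (dGs l i j) (dGs i l j) (dGs j l i).
by rewrite (dGs l j i); field.
Qed.

Lemma christoffel_formDr (u v w1 w2 : 'rV[R]_m) :
  christoffel_form u v (w1 + w2) = christoffel_form u v w1 + christoffel_form u v w2.
Proof.
rewrite -big_split; apply: eq_bigr => i _; rewrite -big_split; apply: eq_bigr => j _.
by rewrite -big_split; apply: eq_bigr => l _; rewrite mxE mulrDr.
Qed.

Lemma christoffel_formZr (u v w : 'rV[R]_m) (t : R) :
  christoffel_form u v (t *: w) = t * christoffel_form u v w.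
Proof.
rewrite mulr_sumr; apply: eq_bigr => i _; rewrite mulr_sumr; apply: eq_bigr => j _.
by rewrite mulr_sumr; apply: eq_bigr => l _; rewrite mxE; ring.
Qed.
End LoweredChristoffel.

Lemma inner_row (R : realType) (m p : nat) (G : 'M[R]_m) (X : 'rV[R]_m)
    (B : 'M[R]_(p, m)) b : inner G X (row b B) = (X *m G *m B^T) 0 b.
Proof.
rewrite /inner; move: (X *m G) => Z; rewrite !mxE.
by apply: eq_bigr => k _; rewrite !mxE.
Qed.

Section DifferenceQuotients.
Variable R : realType.

Lemma quot_cvg (q : R -> R) (q0 q1 : R) :
  h^-1 * (q h - q0) @[h --> (0 : R)^'] --> q1 -> q h @[h --> (0 : R)^'] --> q0.
Proof.
move=> Hq.
have H : h * (h^-1 * (q h - q0)) @[h --> (0 : R)^'] --> (0 : R) * q1.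
  by apply: cvg_mulr => //; exact: (@cvg_within _ (nbhs (0 : R))).
have {}H : q0 + h * (h^-1 * (q h - q0)) @[h --> (0 : R)^'] --> q0 + (0 : R) * q1.
  by apply: cvg_addr => //; exact: cvg_cst.
move: H; rewrite mul0r addr0; apply: cvg_trans; apply: near_eq_cvg.
near=> h; have h0 : h != 0 by near: h; exact: nbhs_dnbhs_neq.
by rewrite mulVKf// addrC subrK.
Unshelve. all: by end_near. Qed.

Lemma quot_mul (p q : R -> R) (p0 q0 p1 q1 : R) :
  h^-1 * (p h - p0) @[h --> (0 : R)^'] --> p1 ->
  h^-1 * (q h - q0) @[h --> (0 : R)^'] --> q1 ->
  h^-1 * (p h * q h - p0 * q0) @[h --> (0 : R)^'] --> p1 * q0 + p0 * q1.
Proof.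
move=> Hp Hq; have cq := quot_cvg Hq.
have : h^-1 * (p h - p0) * q h + p0 * (h^-1 * (q h - q0)) @[h --> (0 : R)^']
  --> p1 * q0 + p0 * q1 by apply: cvg_addr; [exact: cvg_mulr|exact: cvgMl_tmp].
apply: cvg_trans; apply: near_eq_cvg; apply: nearW => h; ring.
Qed.

End DifferenceQuotients.

Section PartialDerivativesOn.
Variables (R : realType) (m : nat) (P : pred 'I_m) (A : set 'rV[R]_m).
Hypothesis oA : orthant_open P A.

Lemma pderiv_quot k (f : 'rV[R]_m -> R) x : pderivable A k f x -> A x ->
  interior_pt P x ->
  h^-1 * (f (x + h *: delta_mx 0 k) - f x) @[h --> (0 : R)^'] --> pderiv A k f x.
Proof.
move=> fx Ax ix; have := fx; rewrite /pderivable /pderiv (pincr_interior oA Ax)//.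
exact: ix.
Qed.

Lemma near_shift x k : A x -> interior_pt P x ->
  \forall h \near (0 : R)^', A (x + h *: delta_mx 0 k).
Proof.
move=> Ax ix; apply: nbhs_dnbhs.
have H : \forall h \near (0 : R), A (x + h *: delta_mx 0 k) /\
    interior_pt P (x + h *: delta_mx 0 k).
  have := @line_continuous R m x (delta_mx 0 k) 0.
  by rewrite scale0r addr0 => /(_ _ (near_interior oA Ax ix)).
by apply: filterS H => h [].
Qed.

Lemma pderiv_cst k (c : R) x : A x -> pderiv A k (fun=> c) x = 0.
Proof.
move=> Ax; apply: (pderivE oA Ax).
have -> : pdiff_quot k (fun=> c) x = fun=> 0.
  by apply/funext => h; rewrite /pdiff_quot subrr mulr0.
exact: cvg_cst.
Qed.

Lemma pderiv_congr k (f g : 'rV[R]_m -> R) x : A x -> (forall y, A y -> f y = g y) ->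
  pderiv A k f x = pderiv A k g x.
Proof.
move=> Ax fg; rewrite /pderiv; congr (lim _).
have pF := pincr_proper oA k Ax.
have E : \forall h \near pincr A k x, pdiff_quot k f x h = pdiff_quot k g x h.
  have H : \forall h \near pincr A k x, A (x + h *: delta_mx 0 k).
    exact: near_withinT.
  by apply: filterS H => h Ah; rewrite /pdiff_quot !fg.
apply/seteqP; split; apply: near_eq_cvg => //.
by apply: filterS E => h ->.
Qed.

End PartialDerivativesOn.

(** * The equation of the height in a pair of charts *)

Section Hypersurface.
Variables (R : realType) (n : nat) (P : pred 'I_n) (Q : pred 'I_(n + 1)).
Variables (D : set 'rV[R]_n) (A : set 'rV[R]_(n + 1)).
Hypotheses (oD : orthant_open P D) (oA : orthant_open Q A).
Variables (G : 'rV[R]_(n + 1) -> 'M[R]_(n + 1)) (psi : 'rV[R]_(n + 1) -> R).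
Variables Y W : 'rV[R]_n -> 'rV[R]_(n + 1).
Let top : 'I_(n + 1) := rshift n ord0.
Hypothesis G_C1 : forall k l, Ck_on A 1 (fun y => G y k l).
Hypothesis G_posdef : forall y, A y -> posdef (G y).
Hypothesis G_top : forall y, A y -> forall k, G y k top = (k == top)%:R.
Hypothesis dG_top : forall y, A y -> forall k l,
  pderiv A top (fun z => G z k l) y = 0.
Hypothesis psi_cvg : forall y, A y -> forall l,
  pderiv A l psi z @[z --> within A (nbhs y)] --> pderiv A l psi y.
Hypothesis Y_C2 : forall k, Ck_on D 2 (fun u => Y u 0 k).
Hypothesis YA : forall u, D u -> A (Y u).
Hypothesis Y_rank : forall u, D u -> \rank (jac D Y u) = n.
Hypothesis W_C1 : forall k, Ck_on D 1 (fun u => W u 0 k).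
Hypothesis W_unit : forall u, D u -> inner (G (Y u)) (W u) (W u) = 1.
Hypothesis W_orth : forall u, D u -> forall c : 'rV[R]_n,
  inner (G (Y u)) (W u) (c *m jac D Y u) = 0.

Let J u := jac D Y u.
Let gam u := first_form G D Y u.

Definition second_deriv u (a b : 'I_n) : 'rV[R]_(n + 1) :=
  \row_k pderiv D a (pderiv D b (fun z => Y z 0 k)) u.

(* < nabla_a d_b Y, w >, written without the inverse metric. *)
Definition hess_form u (a b : 'I_n) (w : 'rV[R]_(n + 1)) : R :=
  inner (G (Y u)) (second_deriv u a b) w +
  christoffel_form A G (Y u) (row a (J u)) (row b (J u)) w.

Lemma dG_sym y i j l : A y ->
  pderiv A i (fun z => G z j l) y = pderiv A i (fun z => G z l j) y.
Proof.
move=> Ay; apply: (pderiv_congr oA) => // z Az.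
by have [Gs _] := G_posdef Az; rewrite -[in LHS]Gs mxE.
Qed.

Lemma dG_top_r y i j : A y -> pderiv A i (fun z => G z j top) y = 0.
Proof.
move=> Ay; rewrite -(pderiv_cst oA i (j == top)%:R Ay).
by apply: (pderiv_congr oA) => // z Az; exact: G_top.
Qed.

(** [Y u] may be a boundary point of [A] although [u] is interior; the chain rule is applied there
    with relative derivatives of the metric. *)
Lemma metric_quot u a k l : D u -> interior_pt P u ->
  h^-1 * (G (Y (u + h *: delta_mx 0 a)) k l - G (Y u) k l) @[h --> (0 : R)^'] -->
  \sum_i pderiv A i (fun z => G z k l) (Y u) * J u a i.
Proof.
move=> Du iu.
apply: (chain_rule oA (G_C1 k l) (YA Du)).
  by apply: filterS (near_shift oD a Du iu) => h; exact: YA.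
move=> i; rewrite mxE; apply: (pderiv_quot oD) => //.
by have [_ /(_ a)[H _]] := Y_C2 i; exact: H.
Qed.

(** The Weingarten equation: the product of [W] with the tangent vector [b] vanishes near [u], hence
    so does its derivative in direction [a]. Compatibility distributes the derivative of the metric
    over the two covariant derivatives. *)
Lemma cov_deriv_normal u a b : D u -> interior_pt P u ->
  inner (G (Y u)) (cov_deriv A G D Y W a u) (row b (J u)) = - hess_form u a b (W u).
Proof.
move=> Du iu; have Ay := YA Du.
have near0 := near_shift oD a Du iu.
pose term z k l := W z 0 k * G (Y z) k l * J z b l.
have orth0 z : D z -> \sum_k \sum_l term z k l = 0.
  move=> Dz; rewrite -[RHS](W_orth Dz (delta_mx 0 b)) -rowE innerE.
  apply: eq_bigr => k _; apply: eq_bigr => l _; rewrite /term; congr (_ * _).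
  by rewrite [RHS]mxE.
pose T k l := (pderiv D a (fun z => W z 0 k) u * G (Y u) k l +
     W u 0 k * \sum_i pderiv A i (fun z => G z k l) (Y u) * J u a i) * J u b l +
    W u 0 k * G (Y u) k l * pderiv D a (pderiv D b (fun z => Y z 0 l)) u.
have L k l : h^-1 * (term (u + h *: delta_mx 0 a) k l - term u k l)
    @[h --> (0 : R)^'] --> T k l.
  apply: quot_mul; first apply: quot_mul.
  - apply: (pderiv_quot oD) => //; have [_ /(_ a)[H _]] := W_C1 k; exact: H.
  - exact: metric_quot.
  - have [_ /(_ b)[_ [_ /(_ a)[H _]]]] := Y_C2 l.
    have := pderiv_quot oD (H _ Du) Du iu.
    apply: cvg_trans; apply: near_eq_cvg; apply: nearW => h.
    by rewrite /J !mxE.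
have S : \sum_k \sum_l h^-1 * (term (u + h *: delta_mx 0 a) k l - term u k l)
    @[h --> (0 : R)^'] --> \sum_k \sum_l T k l.
  by apply: cvg_sumr => k _; apply: cvg_sumr => l _; exact: L.
have Z : (fun h : R => \sum_k \sum_l
    h^-1 * (term (u + h *: delta_mx 0 a) k l - term u k l)) @ (0 : R)^' --> (0 : R).
  have : (fun=> 0 : R) @ (0 : R)^' --> (0 : R) by exact: cvg_cst.
  apply: cvg_trans; apply: near_eq_cvg; apply: filterS near0 => h Dh.
  under eq_bigr do rewrite -mulr_sumr sumrB.
  by rewrite -mulr_sumr sumrB !orth0// subrr mulr0.
have E := cvg_unique (@norm_hausdorff _ R) S Z.
rewrite (@inner_cov_deriv _ _ _ _ (Y u) (G_posdef Ay))//.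
have cf := christoffel_form_compat (row a (J u)) (W u) (row b (J u))
  (fun i j l => dG_sym i j l Ay).
have [Gs _] := G_posdef Ay.
rewrite /hess_form [inner _ (second_deriv _ _ _) _]innerC//.
apply/eqP; rewrite -subr_eq0 opprK; apply/eqP; rewrite -[RHS]E.
have -> : \sum_k \sum_l T k l =
    inner (G (Y u)) (row a (jac D W u)) (row b (J u)) +
    \sum_j \sum_l (\sum_i pderiv A i (fun z => G z j l) (Y u) * row a (J u) 0 i) *
      W u 0 j * row b (J u) 0 l +
    inner (G (Y u)) (W u) (second_deriv u a b).
  rewrite !innerE -!big_split; apply: eq_bigr => k _.
  rewrite -!big_split; apply: eq_bigr => l _; rewrite /T !mxE /=.
  under [in RHS]eq_bigr do rewrite mxE.
  by rewrite /J; ring.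
by rewrite -cf; ring.
Qed.

Lemma xiE : @xi R n = delta_mx 0 top.
Proof.
apply/rowP => k; rewrite /xi /top; case: (split_ordP k) => j ->.
  by rewrite row_mxEl !mxE eqxx eq_lrshift.
by rewrite row_mxEr !mxE ord1 !eqxx.
Qed.

Lemma inner_xi u w : D u -> inner (G (Y u)) w (@xi R n) = w 0 top.
Proof.
move=> Du; rewrite innerE (bigD1 top)//= [X in _ + X]big1 ?addr0; last first.
  move=> k kt; rewrite big1// => l _; rewrite xiE mxE eqxx /=.
  have [->|_] := eqVneq l top; last by rewrite mulr0.
  by rewrite (G_top (YA Du)) (negbTE kt) mulr0 mul0r.
rewrite (bigD1 top)//= [X in _ + X]big1 ?addr0.
  by rewrite xiE mxE !eqxx mulr1 (G_top (YA Du)) eqxx mulr1.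
by move=> l lt; rewrite xiE mxE eqxx /= (negbTE lt) mulr0.
Qed.

Lemma first_form_posdef u : D u -> posdef (gam u).
Proof.
move=> Du; have [Gs Gp] := G_posdef (YA Du); split.
  by rewrite /gam /first_form !trmx_mul trmxK Gs mulmxA.
move=> c c0; have -> : inner (gam u) c c = inner (G (Y u)) (c *m J u) (c *m J u).
  by rewrite /inner /gam /first_form trmx_mul !mulmxA.
apply: Gp; apply: contraNneq c0 => cJ.
have fJ : row_free (J u) by rewrite /row_free Y_rank.
by rewrite -(mulmx_free_eq0 c fJ) cJ.
Qed.

(* The frame formed by the coordinate vectors and the normal has Gram matrix
   [diag(first_form, 1)]. *)
Lemma normal_decomposition u X : D u ->
  X = X *m G (Y u) *m (J u)^T *m invmx (gam u) *m J u
      + inner (G (Y u)) X (W u) *: W u.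
Proof.
move=> Du; have [Gs _] := G_posdef (YA Du).
have gu := posdef_unit (first_form_posdef Du).
have WJ : W u *m G (Y u) *m (J u)^T = 0.
  by apply/rowP => b; rewrite -inner_row rowE W_orth// mxE.
have JW : J u *m G (Y u) *m (W u)^T = 0.
  by apply: trmx_inj; rewrite trmx0 !trmx_mul trmxK Gs mulmxA.
have WW : W u *m G (Y u) *m (W u)^T = 1%:M.
  by rewrite [LHS]mx11_scalar; congr (_%:M); exact: W_unit.
pose Fr := col_mx (J u) (W u).
have gram : Fr *m G (Y u) *m Fr^T = block_mx (gam u) 0 0 1%:M.
  by rewrite mul_col_mx tr_col_mx mul_col_row JW WJ WW.
pose B := block_mx (invmx (gam u)) 0 0 (1%:M : 'M[R]_1).
have : Fr *m (G (Y u) *m Fr^T *m B) = 1%:M.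
  rewrite !mulmxA gram mulmx_block !mulmx0 !mul0mx !addr0 !add0r mulmxV// mulmx1.
  by rewrite -scalar_mx_block.
move/mulmx1C => E.
rewrite -[LHS]mulmx1 -E !mulmxA tr_col_mx mul_mx_row mul_row_block.
rewrite !mulmx0 !addr0 !add0r mulmx1 mul_row_col; congr (_ + _).
by rewrite [X in X *m _]mx11_scalar mul_scalar_mx.
Qed.

Let f := fun z => Y z 0 top.

Lemma grad_height u a : grad D f u 0 a = J u a top.
Proof. by rewrite !mxE. Qed.

Definition angle u : R := inner (G (Y u)) (@xi R n) (W u).

(** The components of the gradient of the height for the induced metric, which is the tangential
    part of the vertical field. *)
Let slope u : 'rV[R]_n := grad D f u *m invmx (gam u).

Lemma xi_decomposition u : D u -> @xi R n = slope u *m J u + angle u *: W u.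
Proof.
move=> Du; rewrite {1}(normal_decomposition (@xi R n) Du) /slope.
congr (_ *m _ *m _ + _); apply/rowP => a; rewrite grad_height.
have [Gs _] := G_posdef (YA Du).
have -> : J u a top = row a (J u) 0 top by rewrite [RHS]mxE.
by rewrite -(inner_xi _ Du) innerC// inner_row.
Qed.

(** Pythagoras for the unit vector [xi], split into its tangential and normal parts. *)
Lemma height_gradient u : D u ->
  inner (invmx (gam u)) (grad D f u) (grad D f u) + angle u ^+ 2 = 1.
Proof.
move=> Du; have xx : inner (G (Y u)) (@xi R n) (@xi R n) = 1.
  by rewrite inner_xi// xiE mxE !eqxx.
rewrite -[RHS]xx {1}(xi_decomposition Du) innerDl innerZl.
have [Gs _] := G_posdef (YA Du).
rewrite [inner _ (W u) _]innerC// -/(angle u) expr2; congr (_ + _).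
rewrite inner_xi// [RHS]mxE /inner [LHS]mxE; apply: eq_bigr => a _.
by rewrite [(grad _ _ _)^T _ _]mxE grad_height.
Qed.

Lemma hess_formD u a b w1 w2 :
  hess_form u a b (w1 + w2) = hess_form u a b w1 + hess_form u a b w2.
Proof. by rewrite /hess_form innerDr christoffel_formDr; ring. Qed.

Lemma hess_formZ u a b t w : hess_form u a b (t *: w) = t * hess_form u a b w.
Proof. by rewrite /hess_form innerZr christoffel_formZr; ring. Qed.

Lemma hess_form_sum u a b (t : 'rV[R]_n) :
  hess_form u a b (t *m J u) = \sum_e t 0 e * hess_form u a b (row e (J u)).
Proof.
have h0 : hess_form u a b 0 = 0 by rewrite -(scale0r 0) hess_formZ mul0r.
rewrite mulmx_sum_row (big_morph _ (hess_formD u a b) h0).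
by apply: eq_bigr => e _; rewrite hess_formZ.
Qed.

(** The lowered symbols with last index [top] vanish for a product metric, which is how [xi] being
    parallel enters. The left side is the plain coordinate Hessian; the induced Christoffel symbols
    appear once [xi] is decomposed. *)
Lemma hess_height u a b : D u -> hess D f u a b = hess_form u a b (@xi R n).
Proof.
move=> Du; rewrite /hess_form inner_xi// !mxE [X in _ + X](_ : _ = 0) ?addr0//.
rewrite /christoffel_form big1// => i _; rewrite big1// => j _; rewrite big1// => l _.
rewrite xiE !mxE eqxx /=; have [->|_] := eqVneq l top; last by rewrite mulr0.
have Ay := YA Du.
by rewrite /lower_christoffel !dG_top_r// dG_top// addr0 subr0 mulr0 !mul0r.
Qed.

(** The first-order coefficients of the weighted Laplacian of the hypersurface: [hess_form] on a
    tangent vector [row e] is an induced Christoffel symbol of the first kind, and the last sum is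
    the derivative of the weight along the hypersurface. *)
Definition drift u : 'rV[R]_n := \row_d (- \sum_e invmx (gam u) d e *
  (\sum_a \sum_b invmx (gam u) a b * hess_form u a b (row e (J u))
   - \sum_l pderiv A l psi (Y u) * J u e l)).

(** The decomposition of [xi] is inserted in the Hessian of the height and in the vertical
    derivative of [psi]. The tangential parts cancel against the drift, and the normal parts form
    the weighted mean curvature. *)
Lemma height_equation u : D u -> interior_pt P u ->
  \tr (invmx (gam u) *m hess D f u) + dotv (drift u) (grad D f u) =
  angle u * (- div_along A G D Y W u
             - inner (G (Y u)) (gradient A G psi (Y u)) (W u))
  + pderiv A top psi (Y u).
Proof.
move=> Du iu; have [gs _] := posdef_inv (first_form_posdef Du).
have gss k l : invmx (gam u) k l = invmx (gam u) l k by rewrite -{1}gs mxE.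
pose p l := pderiv A l psi (Y u).
pose X e := \sum_a \sum_b invmx (gam u) a b * hess_form u a b (row e (J u)).
have trE : \tr (invmx (gam u) *m hess D f u) =
    \sum_e slope u 0 e * X e - angle u * div_along A G D Y W u.
  have -> : \tr (invmx (gam u) *m hess D f u) =
      \sum_a \sum_b invmx (gam u) a b * hess D f u a b.
    rewrite /mxtrace [RHS]exchange_big /=; under eq_bigr do rewrite mxE.
    apply: eq_bigr => a _; apply: eq_bigr => b _.
    by rewrite gss.
  rewrite /div_along !mulr_sumr -sumrN.
  have -> : \sum_e slope u 0 e * X e = \sum_a \sum_b \sum_e
      slope u 0 e * (invmx (gam u) a b * hess_form u a b (row e (J u))).
    under eq_bigr => e _ do rewrite /X mulr_sumr.
    rewrite exchange_big /=; apply: eq_bigr => a _.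
    under eq_bigr => e _ do rewrite mulr_sumr.
    by rewrite exchange_big.
  rewrite -big_split /=; apply: eq_bigr => a _.
  rewrite mulr_sumr -sumrN -big_split /=; apply: eq_bigr => b _.
  rewrite -/(J u) cov_deriv_normal// hess_height// {1}(xi_decomposition Du).
  rewrite hess_formD hess_form_sum hess_formZ mulrDr mulr_sumr; congr (_ + _).
    by apply: eq_bigr => e _; ring.
  by rewrite /gam; ring.
have driftE : dotv (drift u) (grad D f u) =
    - \sum_e slope u 0 e * (X e - \sum_l p l * J u e l).
  rewrite /dotv /drift; under eq_bigr do rewrite mxE mulNr mulr_suml.
  rewrite sumrN exchange_big /=; congr (- _); apply: eq_bigr => e _.
  by rewrite [slope u 0 e]mxE mulr_suml; apply: eq_bigr => d _; rewrite -/(X e); ring.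
have psiE : p top = \sum_e slope u 0 e * (\sum_l p l * J u e l) +
    angle u * inner (G (Y u)) (gradient A G psi (Y u)) (W u).
  rewrite inner_gradient; last exact: G_posdef (YA Du).
  have -> : p top = \sum_l p l * @xi R n 0 l.
    rewrite (bigD1 top)//= xiE mxE !eqxx mulr1 big1 ?addr0// => l lt.
    by rewrite mxE (negbTE lt) andbF mulr0.
  rewrite (xi_decomposition Du).
  have E l : (slope u *m J u + angle u *: W u) 0 l =
      \sum_e slope u 0 e * J u e l + angle u * W u 0 l.
    by move: (slope u) (J u) => s B; rewrite !mxE.
  under eq_bigr => l _ do rewrite E mulrDr.
  rewrite big_split /= mulr_sumr; congr (_ + _); last first.
    by apply: eq_bigr => l _; rewrite -/(p l); ring.
  under eq_bigr => l _ do rewrite mulr_sumr.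
  rewrite exchange_big /=; apply: eq_bigr => e _; rewrite mulr_sumr.
  by apply: eq_bigr => l _; ring.
rewrite driftE.
have -> : \sum_e slope u 0 e * (X e - \sum_l p l * J u e l) =
    \sum_e slope u 0 e * X e - \sum_e slope u 0 e * (\sum_l p l * J u e l).
  by rewrite -sumrB; apply: eq_bigr => e _; rewrite mulrBr.
by rewrite trE -/(p top) psiE; ring.
Qed.

Section Continuity.
Variable u : 'rV[R]_n.
Hypothesis Du : D u.
Let F := within D (nbhs u).
Let FF : Filter F := within_filter D (nbhs_filter u).

Lemma cvg_position : Y @ F --> within A (nbhs (Y u)).
Proof.
have cY : Y @ F --> Y u.
  apply: (@cvg_row R _ F _ Y (Y u) FF) => k.
  by have [/subspace_continuousP cY _] := Y_C2 k; exact: cY.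
have H : \forall x \near F, A (Y x).
  have H : \forall x \near F, D x by exact: near_withinT.
  by apply: filterS H => x; exact: YA.
exact: (@cvg_to_within _ _ F (nbhs (Y u)) A Y FF cY H).
Qed.

Lemma cvg_along (phi : 'rV[R]_(n + 1) -> R) :
  {within A, continuous phi} -> phi (Y x) @[x --> F] --> phi (Y u).
Proof.
move=> /subspace_continuousP cphi; apply: (@cvg_comp _ _ _ Y phi F _ _ cvg_position).
exact: cphi (YA Du).
Qed.

Lemma cvg_jac a k : J x a k @[x --> F] --> J u a k.
Proof.
rewrite /J mxE; under eq_cvg do rewrite mxE.
by have [_ /(_ a)[_ [/subspace_continuousP cJ _]]] := Y_C2 k; exact: cJ.
Qed.

Lemma cvg_second_deriv a b k :
  second_deriv x a b 0 k @[x --> F] --> second_deriv u a b 0 k.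
Proof.
rewrite /second_deriv mxE; under eq_cvg do rewrite mxE.
have [_ /(_ b)[_ [_ /(_ a)[_ [/subspace_continuousP cJ _]]]]] := Y_C2 k.
exact: cJ.
Qed.

Lemma cvg_inner_along (v w : 'rV[R]_n -> 'rV[R]_(n + 1)) :
  (forall k, v x 0 k @[x --> F] --> v u 0 k) ->
  (forall k, w x 0 k @[x --> F] --> w u 0 k) ->
  inner (G (Y x)) (v x) (w x) @[x --> F] --> inner (G (Y u)) (v u) (w u).
Proof.
move=> cv cw; rewrite innerE; under eq_cvg do rewrite innerE.
apply: cvg_sumr => k _; apply: cvg_sumr => l _; apply: cvg_mulr => //.
by apply: cvg_mulr => //; exact: (@cvg_along (fun y => G y k l) (G_C1 k l).1).
Qed.

Lemma cvg_row_jac a k : row a (J x) 0 k @[x --> F] --> row a (J u) 0 k.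
Proof.
have E x : row a (J x) 0 k = J x a k by rewrite [LHS]mxE.
by rewrite E; under eq_cvg do rewrite E; exact: cvg_jac.
Qed.

Lemma first_form_inner x a b : gam x a b = inner (G (Y x)) (row a (J x)) (row b (J x)).
Proof. by rewrite inner_row -row_mul -row_mul [RHS]mxE. Qed.

Lemma cvg_invmx_first_form a b :
  invmx (gam x) a b @[x --> F] --> invmx (gam u) a b.
Proof.
apply: cvg_invmx; last exact: posdef_unit (first_form_posdef Du).
move=> k l; rewrite first_form_inner; under eq_cvg do rewrite first_form_inner.
by apply: cvg_inner_along => j; exact: cvg_row_jac.
Qed.

Lemma cvg_hess_form a b e :
  hess_form x a b (row e (J x)) @[x --> F] --> hess_form u a b (row e (J u)).
Proof.
apply: cvg_addr.
  by apply: cvg_inner_along => k; [exact: cvg_second_deriv|exact: cvg_row_jac].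
rewrite /christoffel_form; apply: cvg_sumr => i _; apply: cvg_sumr => j _.
apply: cvg_sumr => l _.
apply: cvg_mulr; last exact: cvg_row_jac.
apply: cvg_mulr; last exact: cvg_row_jac.
apply: cvg_mulr; last exact: cvg_row_jac.
have cdG p q r : pderiv A p (fun z => G z q r) (Y x) @[x --> F] -->
    pderiv A p (fun z => G z q r) (Y u).
  apply: (@cvg_along (fun y => pderiv A p (fun z => G z q r) y)).
  by have [_ /(_ p)[_ []]] := G_C1 q r.
by apply: cvgMl_tmp; apply: cvg_subr => //; apply: cvg_addr.
Qed.

Lemma cvg_drift k : drift x 0 k @[x --> F] --> drift u 0 k.
Proof.
rewrite /drift mxE; under eq_cvg do rewrite mxE.
apply: cvgN; apply: cvg_sumr => e _.
apply: cvg_mulr; first exact: cvg_invmx_first_form.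
apply: cvg_subr; apply: cvg_sumr => a _.
  apply: cvg_sumr => b _; apply: cvg_mulr; first exact: cvg_invmx_first_form.
  exact: cvg_hess_form.
apply: cvg_mulr; last exact: cvg_jac.
apply: (@cvg_comp _ _ _ Y (pderiv A a psi) F _ _ cvg_position).
exact: psi_cvg (YA Du) a.
Qed.
End Continuity.

(** The formula of the drift is hidden from here on: its continuity up to the boundary is what the
    maximum principle asks for. *)
Lemma height_pde : exists b : 'rV[R]_n -> 'rV[R]_n,
  [/\ forall u, D u -> posdef (invmx (first_form G D Y u)),
      forall u, D u -> forall k l,
        invmx (first_form G D Y x) k l @[x --> within D (nbhs u)] -->
        invmx (first_form G D Y u) k l,
      forall u, D u -> forall k, b x 0 k @[x --> within D (nbhs u)] --> b u 0 k,
      forall u, D u -> inner (invmx (first_form G D Y u)) (grad D f u) (grad D f u)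
        + inner (G (Y u)) (@xi R n) (W u) ^+ 2 = 1 &
      forall u, D u -> interior_pt P u ->
        \tr (invmx (first_form G D Y u) *m hess D f u) + dotv (b u) (grad D f u) =
        inner (G (Y u)) (@xi R n) (W u) *
          (- div_along A G D Y W u
           - inner (G (Y u)) (gradient A G psi (Y u)) (W u))
        + pderiv A top psi (Y u)].
Proof.
exists drift; split.
- by move=> u /first_form_posdef; exact: posdef_inv.
- by move=> u Du k l; exact: cvg_invmx_first_form.
- by move=> u Du k; exact: cvg_drift.
- exact: height_gradient.
- exact: height_equation.
Qed.
End Hypersurface.

(** * Charts of the cylinder *)

Section CylinderChart.
Variables (R : realType) (n : nat) (C : set 'rV[R]_n).
Let P : pred 'I_n := fun k => val k == 0%N.
(** For [n = 0] the coordinate of index 0 is the height, which is unconstrained; the second conjunct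
    excludes it. *)
Let Q : pred 'I_(n + 1) := fun k => (val k == 0%N) && (k < n)%N.
Let A : set 'rV[R]_(n + 1) := [set y | C (lsubmx y)].
Let top : 'I_(n + 1) := rshift n ord0.

Lemma half_space_open_orthant : half_space_open C -> orthant_open P C.
Proof.
move=> [U oU ->]; split=> [x [hx _] k /eqP Pk|x [hx Ux]]; first exact: hx.
have : \forall y \near x, U y by exact: open_nbhs_nbhs.
by apply: filterS => y Uy oy; split=> // k /eqP Pk; exact: oy.
Qed.

Hypothesis oC : orthant_open P C.

Lemma cyl_orthant_open : orthant_open Q A.
Proof.
split.
  move=> y Ay k /andP[k0 kn]; have := oC.1 _ Ay (Ordinal kn) k0.
  by rewrite mxE (_ : lshift 1 (Ordinal kn) = k)//; exact: val_inj.
move=> y Ay; have /nbhs_rowP[e e0 eP] := oC.2 _ Ay.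
apply/nbhs_rowP; exists e => // z zy oz; apply: eP => k.
  by rewrite !mxE; exact: zy.
by move=> Pk; rewrite mxE; apply: oz; rewrite /Q /= ltn_ord andbT.
Qed.

Lemma lsubmx_cvg y : A y -> lsubmx @ within A (nbhs y) --> within C (nbhs (lsubmx y)).
Proof.
move=> Ay; apply: cvg_to_within.
  apply: cvg_row => k; rewrite mxE; under eq_cvg do rewrite mxE.
  exact: coord_cvg_within.
have H : \forall z \near within A (nbhs y), A z by exact: near_withinT.
by apply: filterS H.
Qed.

Lemma lsubmx_continuous (phi : 'rV[R]_n -> R) : {within C, continuous phi} ->
  {within A, continuous (phi \o lsubmx)}.
Proof.
move=> /subspace_continuousP cphi; apply/subspace_continuousP => y Ay.
apply: (@cvg_comp _ _ _ lsubmx phi _ _ _ (lsubmx_cvg Ay)); exact: cphi.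
Qed.

Lemma lsubmx_shift_l (y : 'rV[R]_(n + 1)) h l :
  lsubmx (y + h *: delta_mx 0 (lshift 1 l)) = lsubmx y + h *: delta_mx 0 l.
Proof. by apply/rowP => k; rewrite !mxE eq_lshift. Qed.

Lemma lsubmx_shift_r (y : 'rV[R]_(n + 1)) h :
  lsubmx (y + h *: delta_mx 0 top) = lsubmx y.
Proof. by apply/rowP => k; rewrite !mxE eq_lrshift mulr0 addr0. Qed.

Lemma pincr_lift_l y l : pincr A (lshift 1 l) y = pincr C l (lsubmx y).
Proof.
rewrite /pincr (_ : [set h | _] = [set h | C (lsubmx y + h *: delta_mx 0 l)])//.
by apply/seteqP; split=> h; rewrite /A /= lsubmx_shift_l.
Qed.

Lemma pdiff_quot_lift_l (phi : 'rV[R]_n -> R) (w : R -> R) y l :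
  pdiff_quot (lshift 1 l) (fun z => phi (lsubmx z) + w (z 0 top)) y =
  pdiff_quot l phi (lsubmx y).
Proof.
apply/funext => h; rewrite /pdiff_quot lsubmx_shift_l.
by rewrite [in w _]shift_delta eq_rlshift mulr0 addr0; congr (_ * _); ring.
Qed.

Lemma pderiv_lift_l (phi : 'rV[R]_n -> R) (w : R -> R) y l :
  pderiv A (lshift 1 l) (fun z => phi (lsubmx z) + w (z 0 top)) y =
  pderiv C l phi (lsubmx y).
Proof. by rewrite /pderiv pdiff_quot_lift_l pincr_lift_l. Qed.

Lemma pdiff_quot_lift_r (phi : 'rV[R]_n -> R) (w : R -> R) y :
  pdiff_quot top (fun z => phi (lsubmx z) + w (z 0 top)) y =
  fun h => h^-1 * (w (y 0 top + h) - w (y 0 top)).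
Proof.
apply/funext => h; rewrite /pdiff_quot lsubmx_shift_r.
by rewrite [in w _]shift_delta eqxx mulr1; congr (_ * _); ring.
Qed.

Lemma pincr_lift_r y : A y -> pincr A top y = (0 : R)^'.
Proof.
move=> Ay; apply: (pincr_interior cyl_orthant_open) => //.
by rewrite /Q /= ltnNge leq_addr andbF.
Qed.

Lemma pderiv_lift_r (phi : 'rV[R]_n -> R) (w : R -> R) y : A y ->
  derivable w (y 0 top) 1 ->
  pderiv A top (fun z => phi (lsubmx z) + w (z 0 top)) y = derive1 w (y 0 top).
Proof.
move=> Ay dw.
have H : h^-1 * (w (y 0 top + h) - w (y 0 top)) @[h --> (0 : R)^'] -->
    derive1 w (y 0 top).
  by apply: derive_quot; apply: DeriveDef => //; rewrite derive1E.
rewrite -(pincr_lift_r Ay) -(pdiff_quot_lift_r phi w y) in H.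
exact: (pderivE cyl_orthant_open Ay H).
Qed.

Lemma Ck_on_lift (phi : 'rV[R]_n -> R) : Ck_on C 1 phi ->
  Ck_on A 1 (fun y => phi (lsubmx y)).
Proof.
move=> [cphi dphi]; split; first exact: lsubmx_continuous.
have E : (fun y : 'rV[R]_(n + 1) => phi (lsubmx y)) =
    (fun y => phi (lsubmx y) + (fun=> 0) (y 0 top)).
  by apply/funext => y; rewrite addr0.
have ql l y : pdiff_quot (lshift 1 l) (fun y => phi (lsubmx y)) y =
    pdiff_quot l phi (lsubmx y).
  by rewrite E; exact: (@pdiff_quot_lift_l phi (fun=> 0)).
have pl l y : pderiv A (lshift 1 l) (fun y => phi (lsubmx y)) y =
    pderiv C l phi (lsubmx y).
  by rewrite /pderiv ql pincr_lift_l.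
have qr y : pdiff_quot top (fun y => phi (lsubmx y)) y = fun=> 0.
  by apply/funext => h; rewrite /pdiff_quot lsubmx_shift_r subrr mulr0.
move=> k; case: (split_ordP k) => l ->.
  have [dl [cl _]] := dphi l; split.
    by move=> y Ay; rewrite /pderivable ql pincr_lift_l; exact: dl.
  split=> //; rewrite (_ : pderiv _ _ _ = pderiv C l phi \o lsubmx).
    exact: lsubmx_continuous.
  by apply/funext => y; exact: pl.
have -> : rshift n l = top by rewrite (ord1 l); apply: val_inj.
split.
  by move=> y Ay; rewrite /pderivable qr; apply/cvg_ex; exists 0; exact: cvg_cst.
split=> //; apply/subspace_continuousP => y Ay.
have E0 z : A z -> pderiv A top (fun y => phi (lsubmx y)) z = 0.
  by move=> Az; apply: (pderivE cyl_orthant_open) => //; rewrite qr; exact: cvg_cst.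
rewrite /from_subspace E0//.
have c0 : (fun=> 0 : R) @ within A (nbhs y) --> (0 : R) by exact: cvg_cst.
apply: cvg_trans c0; apply: near_eq_cvg.
have H : \forall z \near within A (nbhs y), A z by exact: near_withinT.
by apply: filterS H => z /E0 ->.
Qed.
End CylinderChart.

(** * The height function and the inner conormal *)

Section HeightFunction.
Variables (R : realType) (n : nat) (M : smooth_manifold R n).
Variables (g : riemannian_metric M) (h : M -> R) (v : R -> R) (psi : M * R -> R).
Hypotheses (h_smooth : smooth_fun h) (v_smooth : smooth_on_line v).
Hypothesis psi_weight : forall p t, expR (psi (p, t)) = expR (h p) * expR (v t).
Variables (S : smooth_manifold R n) (F : S -> M * R).
Hypothesis F_immersion : immersion F.
Variable N : chart_index M -> S -> 'rV[R]_(n + 1).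
Hypothesis N_gauss : gauss_map g F N.

Let P : pred 'I_n := fun k => val k == 0%N.
Let top : 'I_(n + 1) := rshift n ord0.

Lemma psiE p t : psi (p, t) = h p + v t.
Proof. by apply: expR_inj; rewrite expRD psi_weight. Qed.

Lemma chart_codomP (T : smooth_manifold R n) (a : chart_index T) u :
  chart_codom a u -> chart_dom a (chart_inv a u) /\ chart a (chart_inv a u) = u.
Proof. by move=> [p ap <-]; rewrite chartK. Qed.

Lemma cyl_metric_posdef (i : chart_index M) y : chart_codom i (lsubmx y) ->
  posdef (cyl_metric g i y).
Proof.
move=> iy; split.
  by rewrite tr_block_mx !trmx0 trmx1 Defs.metric_sym.
move=> u u0; rewrite -[u]hsubmxK /cyl_metric /inner mul_row_block !mulmx0 addr0 add0r.
rewrite mulmx1 tr_row_mx mul_row_col mxE.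
have r0 : 0 <= (rsubmx u *m (rsubmx u)^T) 0 0.
  by rewrite -dotv_mulmx dotv_ge0.
have [l0|l0] := eqVneq (lsubmx u) 0; last first.
  by apply: ltr_wpDr => //; exact: Defs.metric_pos.
rewrite l0 !mul0mx mxE add0r -dotv_mulmx /dotv big_ord1 -expr2 exprn_even_gt0//=.
apply: contraNneq u0 => ru; rewrite -[u]hsubmxK l0.
have -> : rsubmx u = 0 by apply/rowP => k; rewrite ord1 ru mxE.
by rewrite row_mx0.
Qed.

Lemma cyl_metric_top (i : chart_index M) y k :
  cyl_metric g i y k top = (k == top)%:R.
Proof.
case: (split_ordP k) => j ->.
  by rewrite [LHS]block_mxEur mxE eq_lrshift.
have -> : rshift n j = top by rewrite (ord1 j); apply: val_inj.
by rewrite eqxx [LHS]block_mxEdr mxE eqxx.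
Qed.

Section LocalExpression.
Variables (a : chart_index S) (i : chart_index M).
Let D := loc_dom F a i.
Let Y := loc_map F a i.
Let A := @cyl_codom R n M i.
Let G := cyl_metric g i.

Lemma loc_domP u : D u <-> chart_codom a u /\ chart_dom i (F (chart_inv a u)).1.
Proof.
split; first by move=> [p [ap ip] <-]; rewrite chartK//; split=> //; exists p.
move=> [au iu]; have [ap up] := chart_codomP au.
by exists (chart_inv a u).
Qed.

Lemma loc_dom_orthant_open : orthant_open P D.
Proof.
have oa := half_space_open_orthant (chart_codom_open a).
split=> [u /loc_domP[au _]|u /loc_domP[au iu]]; first exact: oa.1.
have E : \forall q \near chart_inv a u, chart_dom i (F q).1.
  have [cF _ _] := F_immersion; apply: open_nbhs_nbhs; split=> //.
  apply: (@open_comp _ _ (fun q => (F q).1)); last exact: chart_dom_open.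
  move=> q _; apply: (@cvg_comp _ _ _ F fst); [exact: cF|exact: cvg_fst].
have /subspace_continuousP /(_ u au _ E) := @chart_inv_continuous _ _ S a.
move=> H; have {}H : \forall x \near u, chart_codom a x ->
   chart_dom i (F (chart_inv a x)).1 by exact: H.
apply: filterS2 H (oa.2 _ au) => x H1 H2 ox; apply/loc_domP.
by split; [exact: H2|exact/H1/H2].
Qed.

Lemma loc_mapA u : D u -> A (Y u).
Proof.
move=> /loc_domP[_ iu]; rewrite /A /cyl_codom /Y /loc_map /cyl_chart /= row_mxKl.
by exists (F (chart_inv a u)).1.
Qed.

Lemma loc_map_top u : Y u 0 top = (F (chart_inv a u)).2.
Proof. by rewrite /Y /loc_map /cyl_chart row_mxEr mxE. Qed.

Let f u := (F (chart_inv a u)).2.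

Lemma height_C2 : Ck_on D 2 f.
Proof.
have [_ F_smooth _] := F_immersion.
have <- : (fun u => Y u 0 top) = f by apply/funext => u; exact: loc_map_top.
exact: F_smooth.
Qed.

Let ang u := cyl_inner g i (F (chart_inv a u)) (@xi R n) (N i (chart_inv a u)).

Lemma local_height_pde : exists b : 'rV[R]_n -> 'rV[R]_n,
  [/\ forall u, D u -> posdef (invmx (first_form G D Y u)),
      forall u, D u -> forall k l,
        invmx (first_form G D Y x) k l @[x --> within D (nbhs u)] -->
        invmx (first_form G D Y u) k l,
      forall u, D u -> forall k, b x 0 k @[x --> within D (nbhs u)] --> b u 0 k,
      forall u, D u -> inner (invmx (first_form G D Y u)) (grad D f u) (grad D f u)
        + ang u ^+ 2 = 1 &
      forall u, D u -> interior_pt P u ->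
        \tr (invmx (first_form G D Y u) *m hess D f u) + dotv (b u) (grad D f u) =
        ang u * weighted_mean_curvature g psi F N a i (chart_inv a u)
        + derive1 v (f u)].
Proof.
have [cF F_smooth F_rank] := F_immersion.
have [_ N_smooth N_unit N_orth] := N_gauss.
have oC := half_space_open_orthant (chart_codom_open i).
have oA := cyl_orthant_open oC.
have fE : (fun u => Y u 0 top) = f by apply/funext => u; exact: loc_map_top.
have psiL : psi \o cyl_chart_inv i =
    (fun z => (h \o chart_inv i) (lsubmx z) + v (z 0 top)).
  by apply/funext => z; rewrite /= /cyl_chart_inv psiE.
have dv (t : R) : derivable v t 1 := @v_smooth 0%N t.
have dpsi_top y : A y -> pderiv A top (psi \o cyl_chart_inv i) y = derive1 v (y 0 top).
  by move=> Ay; rewrite psiL; apply: (pderiv_lift_r oC).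
have psi_cvg y : A y -> forall l,
  pderiv A l (psi \o cyl_chart_inv i) z @[z --> within A (nbhs y)] -->
  pderiv A l (psi \o cyl_chart_inv i) y.
  move=> Ay l; case: (split_ordP l) => j ->.
    have E z : pderiv A (lshift 1 j) (psi \o cyl_chart_inv i) z =
        pderiv (chart_codom i) j (h \o chart_inv i) (lsubmx z).
      by rewrite psiL; exact: pderiv_lift_l.
    rewrite E; under eq_cvg do rewrite E.
    have [_ /(_ j)[_ [cj _]]] := h_smooth i 1%N.
    by move/lsubmx_continuous/subspace_continuousP : cj; exact.
  have -> : rshift n j = top by rewrite (ord1 j); apply: val_inj.
  rewrite dpsi_top//.
  have cv' : derive1 v z @[z --> y 0 top] --> derive1 v (y 0 top).
    have d1 : derivable (derive1 v) (y 0 top) 1 := @v_smooth 1%N _.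
    by apply: differentiable_continuous; apply/derivable1_diffP.
  have H := @cvg_comp _ _ _ (fun z : 'rV[R]_(n + 1) => z 0 top) (derive1 v)
     (within A (nbhs y)) _ _ (@coord_cvg_within _ _ A y top) cv'.
  apply: cvg_trans H; apply: near_eq_cvg.
  have H : \forall z \near within A (nbhs y), A z by exact: near_withinT.
  by apply: filterS H => z Az; rewrite dpsi_top.
have GE y k l : G y (lshift 1 k) (lshift 1 l) = g i (lsubmx y) k l.
  exact: block_mxEul.
have cst (c : R) : Ck_on A 1 (fun=> c).
  have cc (c' : R) (B : set 'rV[R]_(n + 1)) : {within B, continuous (fun=> c')}.
    by apply: continuous_subspaceT; exact: cst_continuous.
  split=> // k; split.
    move=> x Ax; apply/cvg_ex; exists 0.
    have -> : pdiff_quot k (fun=> c) x = fun=> 0.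
      by apply/funext => t; rewrite /pdiff_quot subrr mulr0.
    exact: cvg_cst.
  split=> //; apply/subspace_continuousP => y Ay.
  rewrite /from_subspace (pderiv_cst oA)//.
  have c0 : (fun=> 0 : R) @ within A (nbhs y) --> (0 : R) by exact: cvg_cst.
  apply: cvg_trans c0; apply: near_eq_cvg.
  have H : \forall z \near within A (nbhs y), A z by exact: near_withinT.
  by apply: filterS H => z Az; rewrite (pderiv_cst oA).
have topE j : rshift n j = top by rewrite (ord1 j); apply: val_inj.
have G_top y k : G y k top = (k == top)%:R by exact: cyl_metric_top.
have G_top_l y k : G y top k = (k == top)%:R.
  case: (split_ordP k) => j ->.
    by rewrite [LHS]block_mxEdl mxE eq_lrshift.
  by rewrite topE G_top.
have G_C1 k l : Ck_on A 1 (fun y => G y k l).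
  case: (split_ordP l) => l' ->; last first.
    rewrite topE (_ : (fun y => _) = fun=> (k == top)%:R)//.
    by apply/funext => y; exact: G_top.
  case: (split_ordP k) => k' ->; last first.
    rewrite topE (_ : (fun y => _) = fun=> (lshift 1 l' == top)%:R)//.
    by apply/funext => y; exact: G_top_l.
  rewrite (_ : (fun y => _) = fun y => g i (lsubmx y) k' l'); last first.
    by apply/funext => y; exact: GE.
  by apply: (@Ck_on_lift _ _ _ oC (fun x => g i x k' l')); exact: metric_smooth.
have G_posdef y : A y -> posdef (G y) by exact: cyl_metric_posdef.
have dG_top y : A y -> forall k l, pderiv A top (fun z => G z k l) y = 0.
  move=> Ay k l; apply: (pderivE oA Ay).
  have -> : pdiff_quot top (fun z => G z k l) y = fun=> 0.
    apply/funext => t; rewrite /pdiff_quot /G /cyl_metric lsubmx_shift_r.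
    by rewrite subrr mulr0.
  exact: cvg_cst.
have DF u : D u -> [/\ chart_dom a (chart_inv a u), chart a (chart_inv a u) = u &
    chart_dom i (F (chart_inv a u)).1].
  by move=> /loc_domP[/chart_codomP[? ?] ?].
have Y_rank u : D u -> \rank (jac D Y u) = n.
  by move=> /DF[au ua iu]; have := F_rank a i _ au iu; rewrite /loc_jac ua.
have W_unit u : D u -> inner (G (Y u)) (N i (chart_inv a u)) (N i (chart_inv a u)) = 1.
  by move=> /DF[au ua iu]; exact: N_unit.
have W_orth u : D u -> forall c : 'rV[R]_n,
    inner (G (Y u)) (N i (chart_inv a u)) (c *m jac D Y u) = 0.
  by move=> /DF[au ua iu] c; have := N_orth a i _ au iu c; rewrite /loc_jac ua.
have [b [h1 h2 h3 h4 h5]] := @height_pde R n P _ D A loc_dom_orthant_open oA G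
  (psi \o cyl_chart_inv i) Y (N i \o chart_inv a) G_C1 G_posdef
  (fun y _ => G_top y) dG_top psi_cvg
  (fun k => F_smooth a i k 2%N) loc_mapA Y_rank (fun k => N_smooth a i k 1%N)
  W_unit W_orth.
exists b; rewrite -/top fE in h4 h5; split=> //.
move=> u Du iu; rewrite h5// dpsi_top; last exact: loc_mapA.
rewrite loc_map_top /weighted_mean_curvature.
by have [_ ua _] := DF u Du; rewrite ua.
Qed.

(** Read off from the Pythagorean identity, whose gradient term is nonnegative. *)
Lemma angle_sqr_le1 u : D u -> ang u ^+ 2 <= 1.
Proof.
move=> Du; have [b [Gp _ _ E _]] := local_height_pde.
rewrite -(E u Du) lerDr; have [_ Gp'] := Gp u Du.
have [->|/Gp'/ltW//] := eqVneq (grad D f u) 0.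
by rewrite /inner !mul0mx mxE.
Qed.

Hypothesis height_subsol : forall p, chart_dom a p -> chart_dom i (F p).1 ->
  0 <= cyl_inner g i (F p) (@xi R n) (N i p) * weighted_mean_curvature g psi F N a i p
       + derive1 v (F p).2.

Lemma local_subsol (b : 'rV[R]_n -> 'rV[R]_n) :
  (forall u, D u -> interior_pt P u ->
    \tr (invmx (first_form G D Y u) *m hess D f u) + dotv (b u) (grad D f u) =
    ang u * weighted_mean_curvature g psi F N a i (chart_inv a u) + derive1 v (f u)) ->
  forall u, D u -> interior_pt P u ->
  0 <= \tr (invmx (first_form G D Y u) *m hess D f u) + dotv (b u) (grad D f u).
Proof.
move=> E u Du iu; rewrite E//; have /loc_domP[/chart_codomP[au _] iFu] := Du.
exact: height_subsol.
Qed.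

Lemma local_strong_maximum u mx : D u -> interior_pt P u -> f u = mx ->
  (forall q, (F q).2 <= mx) -> \forall x \near u, f x = mx.
Proof.
move=> Du iu fu fle; have [b [Gp Gc bc _ /local_subsol E]] := local_height_pde.
apply: (strong_maximum loc_dom_orthant_open height_C2 Gp E Gc bc Du iu fu).
by apply: (@filterE _ (nbhs u) (nbhs_filter u)) => x _; exact: fle.
Qed.

(* In the half-space, the barrier of Hopf's lemma is taken along the inward
   coordinate direction. *)
Lemma local_hopf u mx (k0 : 'I_n) : D u -> val k0 = 0%N -> ~ interior_pt P u ->
  f u = mx -> (forall q, (F q).2 <= mx) ->
  (forall x, D x -> interior_pt P x -> f x < mx) ->
  pderiv D k0 f u < 0 /\ forall k, k != k0 -> pderiv D k f u = 0.
Proof.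
move=> Du k00 niu fu fle flt.
have Pk k : P k -> k = k0 by move=> /eqP k0'; apply: val_inj; rewrite /= k0'.
have oD := loc_dom_orthant_open.
have u0 : u 0 k0 = 0.
  have uk : 0 <= u 0 k0 by apply: oD.1 => //; rewrite /P k00.
  apply/eqP; rewrite eq_le uk andbT leNgt; apply/negP => uk0; apply: niu.
  by move=> k /Pk ->.
have [b [Gp Gc bc _ /local_subsol E]] := local_height_pde.
pose d : 'rV[R]_n := delta_mx 0 k0.
have d0 : d != 0.
  apply/eqP => /rowP/(_ k0); rewrite !mxE !eqxx => /eqP.
  by rewrite oner_eq0.
have df k x : D x -> pderivable D k f x.
  by have [_ /(_ k)[H _]] := height_C2; exact: H.
have le_near : \forall x \near u, D x -> f x <= mx.
  by apply: (@filterE _ (nbhs u) (nbhs_filter u)) => x _; exact: fle.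
(* The sphere has radius 1 and is tangent to the boundary hyperplane at [u], so its open ball
   consists of points with positive coordinate [k0]. *)
have lt_near : \forall x \near u, D x -> 0 < sphere_fun d u x -> f x < mx.
  apply: (@filterE _ (nbhs u) (nbhs_filter u)) => x Dx sx; apply: flt => // k /Pk ->.
  rewrite ltNge; apply/negP => xk; move: sx; apply/negP; rewrite -leNgt.
  rewrite /sphere_fun /d dotvC dotv_delta !mxE u0 subr0.
  have := dotv_ge0 (x - u); lra.
have bd_near : \forall x \near u, D x -> ~ interior_pt P x -> sphere_fun d u x <= 0.
  apply: (@filterE _ (nbhs u) (nbhs_filter u)) => x Dx nix.
  have xk : x 0 k0 <= 0.
    by rewrite leNgt; apply/negP => xk; apply: nix => k /Pk ->.
  rewrite /sphere_fun /d dotvC dotv_delta !mxE u0 subr0.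
  have := dotv_ge0 (x - u); lra.
have [_ [K [e [e0 bar]]]] := @hopf_lemma R n P D oD f height_C2 _ b Gp E u d Du d0
  (Gc u Du) (bc u Du) mx fu le_near lt_near bd_near.
have cd k : pdiff_quot k f u @ pincr D k u --> pderiv D k f u by exact: df.
split.
  have pF := pincr_proper oD k0 Du.
  have [a3 [a4 bl]] := barrier_line d u K u d.
  set a2 := inner _ _ _ / 2 in bl.
  have bl' t : barrier d u K (u + t *: d) = 2 * t + a2 * t ^+ 2 + a3 * t ^+ 3 + a4 * t ^+ 4.
    rewrite bl barrier0 add0r /barrier_grad sphere_fun0 subrr !subr0 !mulr0 scaler0 subr0.
    by rewrite addr0 mulr1 dotvZl dotv_delta mxE !eqxx mulr1.
  have pos : \forall t \near pincr D k0 u, 0 < t.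
    have H1 : \forall t \near pincr D k0 u, D (u + t *: delta_mx 0 k0).
      exact: near_withinT.
    have H2 : \forall t \near pincr D k0 u, t != 0.
      have H0 : \forall t \near (0 : R)^', t != 0 by exact: nbhs_dnbhs_neq.
      exact: (@cvg_within _ (0 : R)^' _ _ _ H0).
    apply: filterS2 H1 H2 => t Dt t0; rewrite lt_neqAle eq_sym t0 /=.
    have := oD.1 _ Dt k0; rewrite shift_delta u0 add0r eqxx mulr1; apply.
    by rewrite /P k00.
  have near0 (B : R -> Prop) : (\forall t \near (0 : R), B t) ->
      \forall t \near pincr D k0 u, B t.
    move=> /nbhs_dnbhs B0; exact: (@cvg_within _ (0 : R)^' _ _ _ B0).
  (* The barrier along the inward direction is [t] times this factor, hence at least [t]; the
     difference quotients of [f] are then at most [- e]. *)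
  have small : \forall t \near pincr D k0 u, 1 < 2 + a2 * t + a3 * t ^+ 2 + a4 * t ^+ 3.
    apply: near0.
    have ct n' : (t : R) ^+ n' @[t --> (0 : R)] --> (0 : R) ^+ n' by exact: exprn_continuous.
    have H : 2 + a2 * t ^+ 1 + a3 * t ^+ 2 + a4 * t ^+ 3 @[t --> (0 : R)] -->
        2 + a2 * 0 ^+ 1 + a3 * 0 ^+ 2 + a4 * 0 ^+ 3.
      apply: cvg_addr; last by apply: cvgMl_tmp; exact: ct.
      apply: cvg_addr; last by apply: cvgMl_tmp; exact: ct.
      by apply: cvg_addr; [exact: cvg_cst|apply: cvgMl_tmp; exact: ct].
    by apply: (cvgr_gt _ H); rewrite !expr0n /= !mulr0 !addr0 ltr1n.
  have barD : \forall t \near pincr D k0 u,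
      f (u + t *: d) <= mx - e * barrier d u K (u + t *: d).
    have H1 : \forall t \near pincr D k0 u, D (u + t *: delta_mx 0 k0).
      exact: near_withinT.
    have H2 : \forall t \near (0 : R), D (u + t *: d) ->
        f (u + t *: d) <= mx - e * barrier d u K (u + t *: d).
      have := @line_continuous R n u d 0.
      by rewrite scale0r addr0 => /(_ _ bar).
    by apply: filterS2 H1 (near0 _ H2) => t Dt; exact.
  apply: (@le_lt_trans _ _ (- e)); last by rewrite oppr_lt0.
  apply: (cvgr_to_le (cd k0)).
  apply: filterS3 pos small barD => t t0 ts tb; rewrite /pdiff_quot /= -/d fu.
  rewrite ler_pdivrMl//; move: tb; rewrite bl'.
  have -> : 2 * t + a2 * t ^+ 2 + a3 * t ^+ 3 + a4 * t ^+ 4 =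
    t * (2 + a2 * t + a3 * t ^+ 2 + a4 * t ^+ 3) by ring.
  move: ts; set s := 2 + _ + _ + _ => ts tb.
  have : e * (t * 1) <= e * (t * s) by rewrite !ler_pM2l// ltW.
  lra.
(* The other directions stay in the boundary hyperplane, so both one-sided quotients exist, and at a
   maximum they have opposite signs. *)
move=> k kk0; have := cd k.
have kP : pincr D k u = 0^'.
  apply: (pincr_interior oD) => // /Pk kk; by rewrite kk eqxx in kk0.
rewrite kP => ck; apply/eqP; rewrite eq_le; apply/andP; split.
  have cr : pdiff_quot k f u @ (0 : R)^'+ --> pderiv D k f u.
    exact: cvg_dnbhs_at_right.
  apply: (cvgr_to_le cr).
  near=> t; have t0 : 0 < t by near: t; exact: nbhs_right_gt.
  by rewrite /= /pdiff_quot pmulr_rle0 ?invr_gt0// subr_le0 fu; exact: fle.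
have cl : pdiff_quot k f u @ (0 : R)^'- --> pderiv D k f u.
  exact: cvg_dnbhs_at_left.
apply: (cvgr_to_ge cl).
near=> t; have t0 : t < 0 by near: t; exact: nbhs_left_lt.
by rewrite /= /pdiff_quot nmulr_rge0 ?invr_lt0// subr_le0 fu; exact: fle.
Unshelve. all: by end_near. Qed.

(** Row [k0] of the inverse first fundamental form pairs with any [y] to its coordinate [y 0 k0]. It
    is therefore orthogonal to the boundary directions and points inwards, and its squared length is
    its own entry [r]. *)
Lemma inner_conormal_exists u (k0 : 'I_n) : D u -> val k0 = 0%N ->
  exists w (c : 'rV[R]_n), [/\ inner_conormal g F a i (chart_inv a u) w, 0 < c 0 k0 &
    cyl_inner g i (F (chart_inv a u)) (@xi R n) w = \sum_k c 0 k * pderiv D k f u].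
Proof.
move=> Du k00; have /loc_domP[/chart_codomP[au ua] iFu] := Du.
have [b [Gp _ _ _ _]] := local_height_pde.
pose gm := first_form G D Y u; pose gi := invmx gm.
have gip : posdef gi := Gp u Du.
have gmp : posdef gm by rewrite -(invmxK gm); exact: posdef_inv.
have [gms _] := gmp.
have JE : loc_jac F a i (chart_inv a u) = jac D Y u by rewrite /loc_jac ua.
have gE (x y : 'rV[R]_n) : cyl_inner g i (F (chart_inv a u))
    (x *m jac D Y u) (y *m jac D Y u) = inner gm x y.
  by rewrite /cyl_inner /inner /gm /first_form trmx_mul !mulmxA.
pose r := gi k0 k0.
have rE : r = inner gi (delta_mx 0 k0) (delta_mx 0 k0).
  by rewrite /inner trmx_delta -rowE -colE !mxE.
have r0 : 0 < r.
  rewrite rE; apply: gip.2; apply/eqP => /rowP/(_ k0); rewrite !mxE !eqxx => /eqP.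
  by rewrite oner_eq0.
have sr0 : 0 < Num.sqrt r by rewrite sqrtr_gt0.
pose c := (Num.sqrt r)^-1 *: row k0 gi.
have cE y : inner gm c y = (Num.sqrt r)^-1 * y 0 k0.
  rewrite innerZl; congr (_ * _).
  by rewrite rowE /inner mulmxKV ?posdef_unit// -dotv_mulmx dotvC dotv_delta.
have ck : c 0 k0 = (Num.sqrt r)^-1 * r by rewrite !mxE.
have c0 : 0 < c 0 k0 by rewrite ck mulr_gt0// invr_gt0.
exists (c *m jac D Y u), c; split=> //.
- split.
  + exists c; first by rewrite JE.
    by move=> k k0'; rewrite (_ : k = k0)//; apply: val_inj; rewrite /= k0' k00.
  + by move=> c' c'0; rewrite JE gE cE c'0// mulr0.
  + rewrite gE cE ck mulrA -expr2 exprVn sqr_sqrtr ?(ltW r0)// mulVf//.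
    by rewrite gt_eqF.
- have [Gs _] := cyl_metric_posdef (loc_mapA Du).
  rewrite /cyl_inner -/(Y u) innerC//.
  have -> : inner (cyl_metric g i (Y u)) (c *m jac D Y u) (@xi R n) =
      (c *m jac D Y u) 0 top.
    exact: (@inner_xi _ _ D A G Y (fun y _ => cyl_metric_top i y) loc_mapA u).
  rewrite mxE; apply: eq_bigr => k _; congr (_ * _); rewrite mxE.
  by congr pderiv; apply/funext => z; exact: loc_map_top.
Qed.
End LocalExpression.

(** * Propagation of the maximum *)

Hypothesis height_subsol : forall a i p, chart_dom a p -> chart_dom i (F p).1 ->
  0 <= cyl_inner g i (F p) (@xi R n) (N i p) * weighted_mean_curvature g psi F N a i p
       + derive1 v (F p).2.

Lemma near_chart a p (B : 'rV[R]_n -> Prop) : @chart_dom _ _ S a p ->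
  (\forall x \near chart a p, B x) -> \forall q \near p, chart_dom a q /\ B (chart a q).
Proof.
move=> ap nB; have od : \forall q \near p, chart_dom a q.
  by apply: open_nbhs_nbhs; split=> //; exact: chart_dom_open.
have /subspace_continuousP /(_ p ap _ nB) := @chart_continuous _ _ S a.
move=> H; have {}H : \forall q \near p, chart_dom a q -> B (chart a q) by exact: H.
by apply: filterS2 od H => q aq Bq; split=> //; exact: Bq.
Qed.

Lemma loc_dom_chart a i p : chart_dom a p -> chart_dom i (F p).1 ->
  loc_dom F a i (chart a p).
Proof. by move=> ap ip; exists p. Qed.

Lemma height_strong_maximum a p mx : chart_dom a p -> interior_pt P (chart a p) ->
  (F p).2 = mx -> (forall q, (F q).2 <= mx) -> \forall q \near p, (F q).2 = mx.
Proof.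
move=> ap ip Fp fle; have [i iFp] := chart_dom_cover (F p).1.
have := local_strong_maximum (height_subsol (a := a) (i := i))
  (loc_dom_chart ap iFp) ip _ fle.
rewrite chartK// => /(_ Fp) /(near_chart ap); apply: filterS => q [aq].
by rewrite chartK.
Qed.

(* The open half of a small cube is convex, so [f = mx] cannot stop inside it. *)
Lemma max_set_interior_closed mx q : (forall q, (F q).2 <= mx) ->
  closure [set p | (F p).2 = mx]° q -> [set p | (F p).2 = mx]° q.
Proof.
move=> fle clq; have [a aq] := chart_dom_cover q.
have [i iFq] := chart_dom_cover (F q).1.
pose D := loc_dom F a i; pose f u := (F (chart_inv a u)).2.
have Du := loc_dom_chart aq iFq; set u := chart a q in Du.
have oD : orthant_open P D := loc_dom_orthant_open a i.
have C2f : Ck_on D 2 f := height_C2 a i.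
have cf x : D x -> f @ within D (nbhs x) --> f x.
  by move=> Dx; have [/subspace_continuousP cf _] := C2f; exact: cf.
have smax x : D x -> interior_pt P x -> f x = mx -> \forall y \near x, f y = mx.
  move=> Dx ix fx.
  exact: (local_strong_maximum (height_subsol (a := a) (i := i)) Dx ix fx fle).
have [r r0 rP] : exists2 r : R, 0 < r & forall x : 'rV[R]_n,
    (forall k, `|x 0 k - u 0 k| < r) -> @orthant R n P x -> D x.
  by apply/nbhs_rowP; exact: oD.2.
have flt x : D x -> f x != mx -> \forall y \near x, D y -> f y != mx.
  move=> Dx; rewrite neq_lt => /orP[fx|]; last by rewrite ltNge /f fle.
  have H : \forall y \near x, D y -> f y < mx by exact: (cvgr_lt _ (cf x Dx) _ fx).
  by apply: filterS H => y H /H /lt_eqF ->.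
have push x (B : 'rV[R]_n -> Prop) : D x -> (forall k, `|x 0 k - u 0 k| < r) ->
    (\forall y \near x, D y -> B y) ->
    exists y, [/\ D y, forall k, `|y 0 k - u 0 k| < r, interior_pt P y & B y].
  move=> Dx xr nB.
  have nxr : \forall y \near x, forall k, `|(y : 'rV[R]_n) 0 k - u 0 k| < r.
    have nk k : \forall y \near x, `|(y : 'rV[R]_n) 0 k - u 0 k| < r.
      apply/nbhs_rowP; exists (r - `|x 0 k - u 0 k|); first by rewrite subr_gt0.
      move=> y yx; have := ler_normD (y 0 k - x 0 k) (x 0 k - u 0 k).
      by have := yx k; rewrite addrA subrK; lra.
    exact: (@filter_forall _ _ _ (nbhs x) (nbhs_filter x) nk).
  have nBx : \forall y \near x, D y -> B y /\ forall k, `|y 0 k - u 0 k| < r.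
    by apply: filterS2 nB nxr => y By yr /By.
  by have [y [Dy iy [By yr]]] := interior_dense oD Dx nBx; exists y.
pose Bx (x : 'rV[R]_n) := forall k, `|x 0 k - u 0 k| < r.
have nq : \forall x \near u, Bx x by apply/nbhs_rowP; exists r.
have nF : \forall p \near q, chart_dom i (F p).1.
  apply: open_nbhs_nbhs; split=> //.
  apply: (@open_comp _ _ (fun p => (F p).1)); last exact: chart_dom_open.
  move=> p _; have [cF _ _] := F_immersion.
  by apply: (@cvg_comp _ _ _ F fst); [exact: cF|exact: cvg_fst].
have nB : \forall p \near q, [/\ chart_dom a p, Bx (chart a p) & D (chart a p)].
  apply: filterS2 (near_chart aq nq) nF => p [ap Bp] iFp.
  by split=> //; exact: loc_dom_chart.
(* Some [p] near [q] has the maximal height on a whole neighbourhood; [p] may be a boundary point,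
   so it is pushed inwards within that neighbourhood. *)
have [x0 [Dx0 Bx0 ix0 fx0]] : exists x0, [/\ D x0, Bx x0, interior_pt P x0 & f x0 = mx].
  have [p [Wp [ap Bp Dp]]] := clq _ nB.
  apply: (push (chart a p)) => //.
  have /subspace_continuousP cinv := @chart_inv_continuous _ _ S a.
  have ca : chart_codom a (chart a p) by exists p.
  have Wp' : nbhs (chart_inv a (chart a p)) [set p | (F p).2 = mx] by rewrite chartK.
  have H : \forall x \near chart a p, chart_codom a x -> f x = mx := cinv _ ca _ Wp'.
  by apply: filterS H => x Hx /loc_domP[/Hx].
have conv x : D x -> Bx x -> interior_pt P x -> f x = mx.
  move=> Dx Bxx ix; pose l (t : R) := x0 + t *: (x - x0).
  have lin (t : R) : 0 <= t <= 1 -> D (l t) /\ interior_pt P (l t).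
    move=> /andP[t0 t1].
    have lE k : l t 0 k = x0 0 k + t * (x 0 k - x0 0 k) by rewrite !mxE.
    have il : interior_pt P (l t).
      by move=> k Pk; rewrite lE; have := ix k Pk; have := ix0 k Pk; nra.
    split=> //; apply: rP => [k|k Pk]; last exact/ltW/il.
    rewrite lE; have := Bxx k; have := Bx0 k; rewrite !ltr_norml.
    move=> /andP[z1 z2] /andP[z3 z4].
    have [t00|tn0] := eqVneq t 0; first by rewrite t00 mul0r addr0; apply/andP.
    have tp : 0 < t by rewrite lt_neqAle eq_sym tn0.
    have h1 : 0 <= (1 - t) * (r - (x0 0 k - u 0 k)) by rewrite mulr_ge0 ?subr_ge0// ltW.
    have h2 : 0 < t * (r - (x 0 k - u 0 k)) by rewrite mulr_gt0 ?subr_gt0.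
    have h3 : 0 <= (1 - t) * (x0 0 k - u 0 k + r) by rewrite mulr_ge0 ?subr_ge0//; lra.
    have h4 : 0 < t * (x 0 k - u 0 k + r) by rewrite mulr_gt0//; lra.
    by apply/andP; split; lra.
  have lc (t : R) (B : 'rV[R]_n -> Prop) : (\forall y \near l t, B y) ->
      \forall s \near t, B (l s).
    by move=> nB'; have := @line_continuous R n x0 (x - x0) t; move=> /(_ _ nB').
  pose I01 : set R := `[0, 1]%classic.
  have I01P t : I01 t <-> 0 <= t <= 1 by rewrite /I01 /= in_itv.
  pose Tm : set R := I01 `&` [set t | f (l t) = mx].
  (* Along the segment from [x0] to [x], which stays in the interior, the maximum set is open by the
     strong maximum principle, closed by continuity, and contains the parameter 0. *)
  have : Tm = I01.
    apply: (@segment_connected R 0 1).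
    - exists 0; split; first by rewrite /I01 /= in_itv /= lexx ler01.
      by rewrite /= /l scale0r addr0.
    - exists ([set t | f (l t) = mx]°); first exact: open_interior.
      apply/seteqP; split=> t [It ft]; split=> //; last exact: interior_subset ft.
      have [Dl il] := lin t ((I01P t).1 It).
      exact: lc (smax _ Dl il ft).
    - exists (closure Tm); first exact: closed_closure.
      apply/seteqP; split=> t.
        by move=> Tt; split; [exact: Tt.1|exact: subset_closure].
      move=> [It clt]; split=> //; have [Dl il] := lin t ((I01P t).1 It).
      apply/eqP; apply: contraT => fl.
      have H := lc t _ (flt _ Dl fl).
      have [s [[Is fs] /(_ (lin s ((I01P s).1 Is)).1)]] := clt _ H.
      by rewrite fs eqxx.
  move=> T1; have : Tm 1 by rewrite T1 /I01 /= in_itv /= lexx ler01.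
  by move=> [_]; rewrite /= /l scale1r addrC subrK.
(* Boundary points of the cube's half follow by density: if [f] differed from [mx] at one of them,
   it would also differ at a nearby interior point. *)
have all x : D x -> Bx x -> f x = mx.
  move=> Dx Bxx; apply/eqP; apply: contraT => fx.
  have [y [Dy By iy /eqP]] := push x _ Dx Bxx (flt x Dx fx).
  by rewrite conv.
apply: filterS nB => p [ap Bp Dp].
by rewrite /= -(all (chart a p))// /f chartK.
Qed.
(** The tangential derivatives of the height vanish at [p], so its derivative along the conormal is
    a positive multiple of the transversal one, which Hopf's lemma makes negative. *)
Lemma conormal_at_max a p mx : chart_dom a p -> ~ interior_pt P (chart a p) ->
  (F p).2 = mx -> (forall q, (F q).2 <= mx) ->
  (forall b q, chart_dom b q -> interior_pt P (chart b q) -> (F q).2 < mx) ->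
  exists i w, [/\ chart_dom i (F p).1, half_space_bd (chart a p),
    inner_conormal g F a i p w & cyl_inner g i (F p) (@xi R n) w < 0].
Proof.
move=> ap nip Fp fle flt; have [i iFp] := chart_dom_cover (F p).1.
have Du := loc_dom_chart ap iFp.
have oD : orthant_open P (loc_dom F a i) := loc_dom_orthant_open a i.
have [k0 [k00 uk]] : exists k0 : 'I_n, val k0 = 0%N /\ chart a p 0 k0 <= 0.
  apply: contrapT => nk; apply: nip => k Pk; rewrite ltNge; apply/negP => uk.
  by apply: nk; exists k; split=> //; exact/eqP.
have bd : half_space_bd (chart a p).
  exists k0; split=> //; apply/eqP; rewrite eq_le uk /=; apply: oD.1 => //.
  exact/eqP.
have [w [c [wc c0 wE]]] := inner_conormal_exists Du k00.
have lt x : loc_dom F a i x -> interior_pt P x -> (F (chart_inv a x)).2 < mx.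
  move=> /loc_domP[/chart_codomP[ax xa] _] ix; apply: (flt a) => //.
  by rewrite xa.
have [d0 dk] :
   pderiv (loc_dom F a i) k0 (fun u => (F (chart_inv a u)).2) (chart a p) < 0 /\
   forall k, k != k0 ->
     pderiv (loc_dom F a i) k (fun u => (F (chart_inv a u)).2) (chart a p) = 0.
  apply: (local_hopf (height_subsol (a := a) (i := i)) Du k00 nip _ fle lt).
  by rewrite chartK.
exists i, w; rewrite chartK// in wc wE; split=> //.
rewrite wE (bigD1 k0)//= [X in _ + X]big1 ?addr0; first by rewrite pmulr_rlt0.
by move=> k /dk ->; rewrite mulr0.
Qed.

(** With a constant height all derivatives drop out of the two identities. They are evaluated at an
    interior point near [p], since the elliptic equation is stated only there. *)
Lemma constant_height s (p : S) : (forall q, (F q).2 = s) ->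
  exists a i q, [/\ chart_dom a q, chart_dom i (F q).1,
    cyl_inner g i (F q) (@xi R n) (N i q) ^+ 2 = 1 &
    cyl_inner g i (F q) (@xi R n) (N i q) *
      weighted_mean_curvature g psi F N a i q + derive1 v s = 0].
Proof.
move=> Fs; have [a ap] := chart_dom_cover p.
have [i iFp] := chart_dom_cover (F p).1.
have oD : orthant_open P (loc_dom F a i) := loc_dom_orthant_open a i.
have [|u [Du iu _]] := @interior_dense _ _ _ _ oD _ (fun=> True) (loc_dom_chart ap iFp).
  by apply: (@filterE _ (nbhs (chart a p)) (nbhs_filter _)).
have /loc_domP[/chart_codomP[au ua] iFu] := Du.
have [b [_ _ _ /(_ u Du) E1 /(_ u Du iu) E2]] := local_height_pde a i.
have fE : (fun u => (F (chart_inv a u)).2) = fun=> s by apply/funext => x.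
have g0 : grad (loc_dom F a i) (fun u => (F (chart_inv a u)).2) u = 0.
  by apply/rowP => k; rewrite !mxE fE (pderiv_cst oD).
have h0 : hess (loc_dom F a i) (fun u => (F (chart_inv a u)).2) u = 0.
  apply/matrixP => k l; rewrite !mxE fE -[RHS](pderiv_cst oD k 0 Du).
  by apply: (pderiv_congr oD) => // x Dx; rewrite (pderiv_cst oD).
exists a, i, (chart_inv a u); split=> //.
  by move: E1; rewrite g0 /inner !mul0mx mxE add0r.
move: E2; rewrite h0 g0 mulmx0 mxtrace0 add0r Fs => <-.
by rewrite /dotv big1// => k _; rewrite mxE mulr0.
Qed.
End HeightFunction.

(** * The height bound and the rigidity of the equality case *)

Theorem proposition3p12 (R : realType) (n : nat)
  (M : smooth_manifold R n) (g : riemannian_metric M)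
  (o : chart_index M -> M -> R)
  (M_complete : riemannian_complete g)
  (M_connected : connected [set: M])
  (M_oriented : orientation o)
  (h : M -> R) (v : R -> R) (psi : M * R -> R) (lambda : R)
  (h_smooth : smooth_fun h) (v_smooth : smooth_on_line v)
  (psi_weight : forall p t, expR (psi (p, t)) = expR (h p) * expR (v t))
  (lambda_ge0 : 0 <= lambda)
  (v_lambda : forall t, lambda <= derive1 v t)
  (S : smooth_manifold R n) (F : S -> M * R)
  (F_immersion : immersion F)
  (S_compact : compact [set: S])
  (S_connected : connected [set: S])
  (S_boundary : mboundary S !=set0)
  (N : chart_index M -> S -> 'rV[R]_(n + 1))
  (N_gauss : gauss_map g F N)
  (curvature :
    (forall a i p, chart_dom a p -> chart_dom i (F p).1 ->
       `|weighted_mean_curvature g psi F N a i p| <= lambda) \/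
    (horizontal_multigraph g F N /\
     forall a i p, chart_dom a p -> chart_dom i (F p).1 ->
       weighted_mean_curvature g psi F N a i p <= lambda))
  (a0 : R)
  (boundary_below : forall p, mboundary S p -> (F p).2 <= a0) :
  (forall p, (F p).2 <= a0) /\
  ((exists p, ~ mboundary S p /\ (F p).2 = a0) \/
   (forall a i p w, chart_dom a p -> chart_dom i (F p).1 ->
      half_space_bd (chart a p) -> inner_conormal g F a i p w ->
      0 <= cyl_inner g i (F p) (@xi R n) w) ->
   exists s : R, derive1 v s = lambda /\ forall p, (F p).2 = s).
Proof.
pose th i p := cyl_inner g i (F p) (@xi R n) (N i p).
have th1 a i p : chart_dom a p -> chart_dom i (F p).1 -> th i p ^+ 2 <= 1.
  move=> ap ip; have := angle_sqr_le1 h_smooth v_smooth psi_weight F_immersion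
    N_gauss (loc_dom_chart ap ip).
  by rewrite chartK.
have subsol a i p : chart_dom a p -> chart_dom i (F p).1 ->
    0 <= th i p * weighted_mean_curvature g psi F N a i p + derive1 v (F p).2.
  move=> ap ip; have := th1 a i p ap ip; have := v_lambda (F p).2.
  rewrite -(real_normK (num_real (th i p))) expr_le1// => vl.
  case: curvature => [/(_ a i p ap ip) Hl|[[_ _ th0] /(_ a i p ap ip) Hl]] t1.
    have : `|th i p * weighted_mean_curvature g psi F N a i p| <= lambda.
      by rewrite normrM -[leRHS]mul1r ler_pM.
    by rewrite ler_norml => /andP[? _]; lra.
  (* Now [th] lies in [[-1, 0]], so a one-sided bound on the curvature [H] is enough:
     [th H >= th lambda >= - lambda]. *)
  have t0 : th i p <= 0 := th0 i p ip.
  by move: t1; rewrite ler_norml => /andP[t1 _]; nra.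
have [pb bpb] := S_boundary.
have cF : continuous (fun p => (F p).2).
  move=> p; have [cF _ _] := F_immersion.
  by apply: (@cvg_comp _ _ _ F snd); [exact: cF|exact: cvg_snd].
have [pm _ pmax] : exists2 c, c \in [set: S] &
    forall t, t \in [set: S] -> (F t).2 <= (F c).2.
  apply: compact_EVT_max => //; first by exists pb.
  exact: continuous_subspaceT.
have {}pmax q : (F q).2 <= (F pm).2 by apply: pmax; exact/mem_set.
pose Z := [set p | (F p).2 = (F pm).2].
(* Connectedness is applied to the interior of [Z], which is open by definition and closed by
   [max_set_interior_closed]. *)
have Zconst : Z° !=set0 -> forall p, (F p).2 = (F pm).2.
  move=> Z0; have ZT : Z° = [set: S].
    apply: S_connected => //.
      by exists (Z°); rewrite ?setTI//; exact: open_interior.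
    exists (closure (Z°)); first exact: closed_closure.
    rewrite setTI; apply/seteqP; split; first exact: subset_closure.
    move=> q; exact: (max_set_interior_closed h_smooth v_smooth psi_weight F_immersion
      N_gauss subsol pmax).
  move=> p; have : Z° p by rewrite ZT.
  by move/interior_subset.
have smax a p := @height_strong_maximum _ _ _ _ _ _ _ h_smooth v_smooth psi_weight
  _ _ F_immersion _ N_gauss subsol a p (F pm).2.
(* One chart that sends a point to the face already puts it in [mboundary], so outside [mboundary]
   every chart sees an interior point. *)
have inner_pt a p : chart_dom a p -> ~ mboundary S p ->
    interior_pt (fun k : 'I_n => val k == 0%N) (chart a p).
  move=> ap nbp k Pk; have oa := half_space_open_orthant (chart_codom_open a).
  have ca : chart_codom a (chart a p) by exists p.
  rewrite lt_neqAle (oa.1 _ ca _ Pk) andbT; apply/eqP => ak; apply: nbp.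
  by exists a => //; exists k; split=> //; exact/eqP.
have mx_le : (F pm).2 <= a0.
  (* A maximum above [a0] would be attained off the boundary, so the height would be constant and
     exceed [a0] also at the boundary point [pb]. *)
  rewrite leNgt; apply/negP => a0m.
  have nb : ~ mboundary S pm by move=> /boundary_below; rewrite leNgt a0m.
  have [a am] := chart_dom_cover pm.
  have Zm : Z° pm by apply: (smax a) => //; exact: inner_pt.
  have := boundary_below _ bpb; rewrite (Zconst (ex_intro _ pm Zm)).
  by rewrite leNgt a0m.
split; first by move=> p; exact: le_trans (pmax p) mx_le.
move=> hyp; exists (F pm).2.
have Fconst : forall p, (F p).2 = (F pm).2.
  apply: Zconst; case: hyp => [[p [nbp Fp]]|nu].
    have [a ap] := chart_dom_cover p.
    have Fpm : (F p).2 = (F pm).2 by apply/eqP; rewrite eq_le pmax Fp mx_le.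
    by exists p; apply: (smax a) => //; exact: inner_pt.
  (* If [Z] has empty interior, no interior point attains the maximum. Then [pm] is a boundary point
     at which Hopf's lemma contradicts the sign of the conormal. *)
  apply: contrapT => nZ; have [a am] := chart_dom_cover pm.
  have nip b q : chart_dom b q ->
      interior_pt (fun k : 'I_n => val k == 0%N) (chart b q) -> (F q).2 < (F pm).2.
    move=> bq iq; rewrite lt_neqAle pmax andbT; apply/eqP => Fq; apply: nZ.
    by exists q; exact: (smax b).
  have nim : ~ interior_pt (fun k : 'I_n => val k == 0%N) (chart a pm).
    by move=> /(nip a pm am); rewrite ltxx.
  have [i [w [im bm wc]]] := conormal_at_max h_smooth v_smooth psi_weight F_immersion
    N_gauss subsol am nim erefl pmax nip.
  by rewrite ltNge (nu a i pm w).
split=> //.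
have [a [i [q [aq iq t1]]]] := constant_height h_smooth v_smooth psi_weight F_immersion
  N_gauss pm Fconst.
rewrite -/(th i q) in t1 *; have := v_lambda (F pm).2.
case: curvature => [/(_ a i q aq iq) Hl|[[_ _ th0] /(_ a i q aq iq) Hl]] vl E.
  apply/eqP; rewrite eq_le vl andbT; apply: le_trans Hl.
  have -> : derive1 v (F pm).2 = - (th i q * weighted_mean_curvature g psi F N a i q).
    by apply/eqP; rewrite -addr_eq0 addrC E.
  apply: le_trans (ler_norm _) _; rewrite normrN normrM.
  have -> : `|th i q| = 1 by apply/eqP; rewrite -sqrp_eq1// real_normK ?num_real// t1.
  by rewrite mul1r.
have t0 : th i q <= 0 := th0 i q iq.
(* With this value [E] says that [v'] at the constant height equals the curvature, which is at most
   [lambda]. *)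
have tE : th i q = -1.
  apply/eqP; have := t1 => /eqP; rewrite sqrf_eq1 => /orP[/eqP t|//].
  by move: t0; rewrite t ler10.
by move: E; rewrite tE; lra.
Qed.
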